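(* Let $t_0<t_1$. Let $f$ be an $\mathbb{R}^n$-valued function of class $C^1$ on some open subset of $\mathbb{R}^n\times\mathbb{R}^p$, and let $(\bar x,\bar u)$ be a $C^1$ trajectory on $[t_0,t_1]$ of the control system $x'=f(x,u)$. Assume that the linearized system around $(\bar x,\bar u)$, $$x'(t)=A(t)x(t)+B(t)u(t)\ \text{ in }[t_0,t_1],\qquad A(t)=f_x(\bar x(t),\bar u(t)),\quad B(t)=f_u(\bar x(t),\bar u(t)),$$ is controllable for the time interval $[t_0,t_1]$. Then the control system $x'=f(x,u)$ is locally controllable along $(\bar x,\bar u)$.
   Context: A $C^1$ trajectory of $x'=f(x,u)$ on $[t_0,t_1]$ is a pair $(x,u)$ of class $C^1$ on $[t_0,t_1]$, with values in the open set where $f$ is defined, such that $x'=f(x,u)$ in $[t_0,t_1]$. The linear system $x'=A(t)x+B(t)u$ is controllable for the time interval $[t_0,t_1]$ if for all $x_0,x_1\in\mathbb{R}^n$ there exists $u\in L^2((t_0,t_1);\mathbb{R}^p)$ such that the solution with $x(t_0)=x_0$ satisfies $x(t_1)=x_1$. The system $x'=f(x,u)$ is locally controllable along $(\bar x,\bar u)$ if for all $\varepsilon>0$ there exists $\delta>0$ such that for all $x_0\in B(\bar x(t_0),\delta)$ and $x_1\in B(\bar x(t_1),\delta)$ there exists a $C^1$ trajectory $(x,u)$ of $x'=f(x,u)$ on $[t_0,t_1]$ with $\|u-\bar u\|_{C^1([t_0,t_1])}\le\varepsilon$, $x(t_0)=x_0$ and $x(t_1)=x_1$. Here $B(a,\delta)$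 is the ball of center $a$ and radius $\delta$ in $\mathbb{R}^n$. *)

(* Defs.v *)
From HB Require Import structures.
From mathcomp Require Import all_boot all_order all_algebra.
From mathcomp Require Import all_classical all_reals all_analysis.

Set Implicit Arguments.
Unset Strict Implicit.
Unset Printing Implicit Defensive.

Import Order.TTheory GRing.Theory Num.Theory.
Import numFieldNormedType.Exports.

Local Open Scope classical_set_scope.
Local Open Scope ring_scope.

Section C1.
Context {R : realType}.

(** Fréchet differentiability on the open set [Om], with a differential that
    is continuous for the operator norm. *)
Definition C1_open {V W : normedModType R} (Om : set V) (f : V -> W) : Prop :=
  (forall z, Om z -> differentiable f z) /\
  (forall z, Om z -> forall e : R, 0 < e ->
     \forall w \near z, forall v, `|'d f w v - 'd f z v| <= e * `|v|).

Definition diff_quot {V : normedModType R} (g : R -> V) (t s : R) : V :=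
  (s - t)^-1 *: (g s - g t).

(** Derivatives relative to a set [D] of times: for [D = `[a, b]] they are
    one-sided at [a] and [b], and no value of [g] outside [D] matters. *)
Definition derivable_in {V : normedModType R} (D : set R) (g : R -> V)
    (t : R) : Prop :=
  cvg (diff_quot g t s @[s --> within D t^']).

Definition derive_in {V : normedModType R} (D : set R) (g : R -> V)
    (t : R) : V :=
  lim (diff_quot g t s @[s --> within D t^']).

Definition C1_in {V : normedModType R} (D : set R) (g : R -> V) : Prop :=
  (forall t, D t -> derivable_in D g t) /\ {within D, continuous (derive_in D g)}.

Definition C1_norm {V : normedModType R} (D : set R) (g : R -> V) : R :=
  sup [set `|g t| | t in D] + sup [set `|derive_in D g t| | t in D].

End C1.

Section Control.
Context {R : realType} {n p : nat}.

Definition C1_trajectory (Om : set ('cV[R]_n * 'cV[R]_p))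
    (f : 'cV[R]_n * 'cV[R]_p -> 'cV[R]_n) (t0 t1 : R)
    (x : R -> 'cV[R]_n) (u : R -> 'cV[R]_p) : Prop :=
  [/\ C1_in `[t0, t1] x,
      C1_in `[t0, t1] u,
      (forall t, t \in `[t0, t1] -> Om (x t, u t)) &
      (forall t, t \in `[t0, t1] -> derive_in `[t0, t1] x t = f (x t, u t))].

Definition L2_in (t0 t1 : R) (u : R -> 'cV[R]_p) : Prop :=
  forall i, (fun t => u t i ord0) \_ `]t0, t1[ \in Lfun lebesgue_measure 2%:E.

(** Since [u] is only square integrable, [x' = A x + B u] is understood in
    integral form: [x] is continuous and
    [x t = x t0 + \int_t0^t (A x + B u)], componentwise. *)
Definition linear_solution (A : R -> 'M[R]_n) (B : R -> 'M[R]_(n, p))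
    (t0 t1 : R) (x : R -> 'cV[R]_n) (u : R -> 'cV[R]_p) : Prop :=
  let F s := A s *m x s + B s *m u s in
  [/\ {within `[t0, t1], continuous x},
      (forall i, lebesgue_measure.-integrable `[t0, t1]
         (fun s => (F s i ord0)%:E)) &
      (forall t, t \in `[t0, t1] -> forall i,
         x t i ord0 = x t0 i ord0 +
           Rintegral lebesgue_measure `[t0, t] (fun s => F s i ord0))].

Definition linear_controllable (A : R -> 'M[R]_n) (B : R -> 'M[R]_(n, p))
    (t0 t1 : R) : Prop :=
  forall x0 x1 : 'cV[R]_n, exists u : R -> 'cV[R]_p, L2_in t0 t1 u /\
    exists x : R -> 'cV[R]_n,
      [/\ linear_solution A B t0 t1 x u, x t0 = x0 & x t1 = x1].

Definition locally_controllable (Om : set ('cV[R]_n * 'cV[R]_p))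
    (f : 'cV[R]_n * 'cV[R]_p -> 'cV[R]_n) (t0 t1 : R)
    (xbar : R -> 'cV[R]_n) (ubar : R -> 'cV[R]_p) : Prop :=
  forall e : R, 0 < e -> exists2 d : R, 0 < d &
    forall x0 x1 : 'cV[R]_n, ball (xbar t0) d x0 -> ball (xbar t1) d x1 ->
    exists (x : R -> 'cV[R]_n) (u : R -> 'cV[R]_p),
      [/\ C1_trajectory Om f t0 t1 x u,
          C1_norm `[t0, t1] (fun t => u t - ubar t) <= e,
          x t0 = x0 & x t1 = x1].

(** Matrix of partial derivatives.  The library's [jacobian] is for row
    vectors, hence is the transpose of the usual one. *)
Definition jacobian_col {m k : nat} (g : 'cV[R]_m -> 'cV[R]_k) (a : 'cV[R]_m) :
    'M[R]_(k, m) :=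
  \matrix_(i, j) ('D_(delta_mx j ord0) g a) i ord0.

Definition jac_x (f : 'cV[R]_n * 'cV[R]_p -> 'cV[R]_n) (x : 'cV[R]_n)
    (u : 'cV[R]_p) : 'M[R]_n := jacobian_col (fun y => f (y, u)) x.

Definition jac_u (f : 'cV[R]_n * 'cV[R]_p -> 'cV[R]_n) (x : 'cV[R]_n)
    (u : 'cV[R]_p) : 'M[R]_(n, p) := jacobian_col (fun v => f (x, v)) u.

End Control.

(* Main.v *)
Require Import Defs.
From mathcomp Require Import all_boot all_order all_algebra.
From mathcomp Require Import all_classical all_reals all_analysis.
From mathcomp Require Import ring lra.
Import Order.TTheory GRing.Theory Num.Theory.
Import numFieldNormedType.Exports.
Local Open Scope classical_set_scope.
Local Open Scope ring_scope.

Set Implicit Arguments.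
Unset Strict Implicit.
Unset Printing Implicit Defensive.

(** Let [Phi], [Psi = Phi^-1] be the resolvents of [x' = A x] and of its
    adjoint.  If [v Psi B = 0] on [`[t0, t1]] then [v Psi x] is constant along
    every solution of the linear system, so controllability forces [v = 0].
    Hence there is a C^1 matrix [W] of controls for which
    [P(t1) = \int Psi B W] is invertible.  One looks for
    [u = ubar + W c] and [x = xbar + Phi y]: the system becomes
    [y' = Psi B W c + Psi rho(t, Phi y, W c)] where [rho], the remainder of the
    first-order expansion of [f] along the trajectory, has an arbitrarily small
    Lipschitz constant near [0], uniformly in [t] by compactness.  With
    [q = Psi rho] as the only unknown, the end conditions determine
    [c = P(t1)^-1 (y(t1) - y(t0) - \int q)], and a contraction in the uniform
    norm yields [q]. *)

(** * Matrix-valued functions of a real variable *)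

(** Two gaps in regularity shape the argument. Controllability supplies controls that are only
    square integrable, whereas closeness in C^1 is wanted. Hence those controls never steer the
    nonlinear system: they serve, by duality, to prove that a matrix is invertible, and the
    corrections [W c] lie in a finite-dimensional family of C^1 controls, where smallness in C^1
    follows from smallness of the vector [c]. Secondly, a solution [x] of the linear system need not
    be differentiable at every time, so the constancy of [v Psi x] cannot come from a product rule;
    an estimate of increments replaces it. Taking [q] as unknown builds the end conditions into
    every iterate: [c] and [y] are affine in [q] with fixed bounds, and the nonlinearity enters only
    through the small Lipschitz constant of the remainder. The reference trajectory matters on the
    segment only, so the coefficients are extended by constants outside it, while the corrections
    have two-sided derivatives even at the ends. *)

Section matrix_norm.
Context {R : realType}.

Lemma mx_entry_le m n (M : 'M[R]_(m, n)) i j : `|M i j| <= `|M|.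
Proof. by rewrite [leRHS]/Num.Def.normr/= mx_normrE; exact: (le_bigmax _ _ (i, j)). Qed.

Lemma mx_norm_le m n (M : 'M[R]_(m, n)) (e : R) : 0 <= e ->
  (forall i j, `|M i j| <= e) -> `|M| <= e.
Proof.
move=> e0 h; rewrite [leLHS]/Num.Def.normr/= mx_normrE.
by rewrite (bigmax_le _ e0)// => -[i j] _; exact: h.
Qed.

Lemma mulmx_norm_le m n k (M : 'M[R]_(m, n)) (N : 'M[R]_(n, k)) :
  `|M *m N| <= n%:R * `|M| * `|N|.
Proof.
apply: mx_norm_le => [|i j]; first by rewrite !mulr_ge0.
rewrite mxE (le_trans (ler_norm_sum _ _ _))//.
rewrite -mulrA mulr_natl -[X in _ *+ X](card_ord n) -sumr_const ler_sum// => l _.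
by rewrite normrM ler_pM// mx_entry_le.
Qed.

End matrix_norm.

Section matrix_calculus.
Context {R : realType}.

Lemma continuous_mxP (T : topologicalType) m n (M : T -> 'M[R]_(m, n)) x :
  {for x, continuous M} <-> forall i j, {for x, continuous (fun y => M y i j)}.
Proof.
split=> [cM i j|cM].
  by apply: (@continuous_comp _ _ _ M (fun N : 'M[R]_(m, n) => N i j)) => //;
    exact: coord_continuous.
apply/cvgrPdist_le => /= e e0; near=> y.
apply: mx_norm_le; first exact: ltW.
near: y; apply: filter_forall => i; apply: filter_forall => j.
have /cvgrPdist_le/(_ _ e0) := cM i j.
by apply: filterS => y; rewrite !mxE.
Unshelve. all: by end_near. Qed.

Lemma continuous_mulmx (T : topologicalType) m n k (M : T -> 'M[R]_(m, n))
    (N : T -> 'M[R]_(n, k)) x :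
  {for x, continuous M} -> {for x, continuous N} ->
  {for x, continuous (fun y => M y *m N y)}.
Proof.
move=> /continuous_mxP cM /continuous_mxP cN; apply/continuous_mxP => i j.
rewrite (_ : (fun _ => _) = (fun y => \sum_l M y i l * N y l j)); last first.
  by apply/funext => y; rewrite mxE.
apply: cvg_big => [|l _]; first exact: add_continuous.
by apply: cvgM; [exact: cM|exact: cN].
Qed.

Lemma within_continuous_mulmx (T : topologicalType) (A : set T)
    m n k (M : T -> 'M[R]_(m, n)) (N : T -> 'M[R]_(n, k)) :
  {within A, continuous M} -> {within A, continuous N} ->
  {within A, continuous (fun y => M y *m N y)}.
Proof. by move=> cM cN t; apply: continuous_mulmx; [exact: cM|exact: cN]. Qed.

Lemma within_continuous_mulmxr (T : topologicalType) (A : set T)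
    m n k (M : T -> 'M[R]_(m, n)) (N : 'M[R]_(n, k)) :
  {within A, continuous M} -> {within A, continuous (fun y => M y *m N)}.
Proof.
move=> cM; have cN : {within A, continuous (fun _ : T => N)}.
  by apply: continuous_subspaceT; exact: cst_continuous.
exact: within_continuous_mulmx cM cN.
Qed.

Lemma continuous_trmx (T : topologicalType) m n (M : T -> 'M[R]_(m, n)) x :
  {for x, continuous M} -> {for x, continuous (fun y => (M y)^T)}.
Proof.
move=> /continuous_mxP cM; apply/continuous_mxP => i j.
rewrite (_ : (fun _ => _) = (fun y => M y j i)); first exact: cM.
by apply/funext => y; rewrite mxE.
Qed.

Lemma is_derive_mxP m n (M : R -> 'M[R]_(m, n)) (t v : R) dM :
  is_derive t v M dM <->
  forall i j, is_derive t v (fun s => M s i j) (dM i j).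
Proof.
split=> [[dM1 dM2] i j|h].
  apply: DeriveDef; first by move/derivable_mxP : dM1; exact.
  by rewrite -dM2 derive_mx// mxE.
have dM1 : derivable M t v.
  by apply/derivable_mxP => i j; have [] := h i j.
apply: DeriveDef => //; rewrite derive_mx//; apply/matrixP => i j; rewrite mxE.
by have [_] := h i j.
Qed.

Lemma is_derive_mulmx m n k (M : R -> 'M[R]_(m, n)) (N : R -> 'M[R]_(n, k))
    (t : R) dM dN :
  is_derive t 1 M dM -> is_derive t 1 N dN ->
  is_derive t 1 (fun s => M s *m N s) (dM *m N t + M t *m dN).
Proof.
move=> /is_derive_mxP hM /is_derive_mxP hN; apply/is_derive_mxP => i j.
rewrite (_ : (fun _ => _) =
  (\sum_l ((fun y => M y i l) * (fun y => N y l j)))); last first.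
  by apply/funext => y; rewrite mxE fct_sumE.
have hl l : is_derive t 1 ((fun y => M y i l) * (fun y => N y l j))
    (M t i l *: dN l j + N t l j *: dM i l).
  exact: is_deriveM.
apply: (is_derive_eq (is_derive_sum hl)).
rewrite !mxE -big_split/=; apply: eq_bigr => l _.
by rewrite addrC [N t l j *: _]mulrC.
Qed.

Lemma is_derive_mulmxr m n k (M : R -> 'M[R]_(m, n)) (N : 'M[R]_(n, k))
    (t : R) dM :
  is_derive t 1 M dM -> is_derive t 1 (fun s => M s *m N) (dM *m N).
Proof.
move=> hM.
by apply: is_derive_eq; [exact: is_derive_mulmx|rewrite mulmx0 addr0].
Qed.

Lemma is_derive_mulmxl m n k (M : 'M[R]_(m, n)) (N : R -> 'M[R]_(n, k))
    (t : R) dN :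
  is_derive t 1 N dN -> is_derive t 1 (fun s => M *m N s) (M *m dN).
Proof.
move=> hN.
by apply: is_derive_eq; [exact: is_derive_mulmx|rewrite mul0mx add0r].
Qed.

Lemma is_derive_trmx m n (M : R -> 'M[R]_(m, n)) (t : R) dM :
  is_derive t 1 M dM -> is_derive t 1 (fun s => (M s)^T) dM^T.
Proof.
move=> /is_derive_mxP h; apply/is_derive_mxP => i j.
rewrite (_ : (fun _ => _) = (fun y => M y j i)); first by rewrite mxE; exact: h.
by apply/funext => y; rewrite mxE.
Qed.

Lemma is_derive_continuous (V : normedModType R) (y : R -> V) (t : R) dy :
  is_derive t 1 y dy -> {for t, continuous y}.
Proof.
by move=> [dy1 _]; apply: differentiable_continuous; exact/derivable1_diffP.
Qed.

(** The norm is the largest absolute entry, so it is enough to apply the scalar mean value theorem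
    to [g + y i j] and [g - y i j], whose derivatives are nonnegative. *)
Lemma mx_mean_value m n (y dy : R -> 'M[R]_(m, n)) (g dg : R -> R) (s t : R) :
  s <= t ->
  (forall r, r \in `[s, t] -> is_derive r 1 y (dy r)) ->
  (forall r, r \in `[s, t] -> is_derive r 1 g (dg r)) ->
  (forall r, r \in `[s, t] -> `|dy r| <= dg r) ->
  `|y t - y s| <= g t - g s.
Proof.
move=> st hy hg hle.
have key (h dh : R -> R) : (forall r, r \in `[s, t] -> is_derive r 1 h (dh r)) ->
    (forall r, r \in `[s, t] -> 0 <= dh r) -> h s <= h t.
  move=> hh dh0.
  have hoo x : x \in `]s, t[ -> is_derive x 1 h (dh x).
    by move=> xst; apply: hh; exact: subset_itv_oo_cc xst.
  have hc : {within `[s, t], continuous h}.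
    by apply: derivable_within_continuous => r /hh[].
  have [c cst e] := MVT_segment st hoo hc.
  by rewrite -subr_ge0 e mulr_ge0 ?subr_ge0//; exact: dh0.
have st0 : 0 <= g t - g s.
  rewrite subr_ge0; apply: (key g dg) => // r rst.
  by apply: le_trans (hle _ rst); exact: normr_ge0.
apply: mx_norm_le => // i j; rewrite !mxE ler_norml.
have h1 : (g + (fun r => y r i j)) s <= (g + (fun r => y r i j)) t.
  apply: (key _ (fun r => dg r + dy r i j)) => r rst.
    apply: is_deriveD; first exact: hg.
    by have /is_derive_mxP := hy _ rst; exact.
  rewrite -lerBlDr sub0r; apply: le_trans (hle _ rst).
  by apply: le_trans (mx_entry_le _ i j); rewrite -normrN ler_norm.
have h2 : (g - (fun r => y r i j)) s <= (g - (fun r => y r i j)) t.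
  apply: (key _ (fun r => dg r - dy r i j)) => r rst.
    apply: is_deriveB; first exact: hg.
    by have /is_derive_mxP := hy _ rst; exact.
  rewrite subr_ge0; apply: le_trans (hle _ rst).
  by apply: le_trans (mx_entry_le _ i j); rewrite ler_norm.
by move: h1 h2; rewrite !fctE/= => h1 h2; apply/andP; split; lra.
Qed.

Lemma mx_lipschitz m n (y dy : R -> 'M[R]_(m, n)) (C s t : R) :
  s <= t ->
  (forall r, r \in `[s, t] -> is_derive r 1 y (dy r)) ->
  (forall r, r \in `[s, t] -> `|dy r| <= C) ->
  `|y t - y s| <= C * (t - s).
Proof.
move=> st hy hC.
have := @mx_mean_value _ _ y dy ( *%R C) (fun=> C) s t st hy _ hC.
rewrite mulrBr; apply => r _.
rewrite (_ : *%R C = C *: (id : R -> R)); last exact/funext.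
by apply: is_derive_eq; rewrite /GRing.scale/= mulr1.
Qed.

End matrix_calculus.

(** * Contractions for the uniform norm *)

Section contraction.
Context {R : realType} {m n : nat} {T : topologicalType}.
Local Notation V := 'M[R]_(m, n).

(** Pointwise bounds [e] replace the uniform norm, and the geometric bound [k ^+ i * (2 * r)] on the
    iterates of 0 replaces completeness: it gives pointwise limits, and its independence of [t]
    makes the limit continuous. *)
Lemma uniform_contraction_fixpoint (F : (T -> V) -> (T -> V)) (r k : R) :
  0 <= r -> 0 <= k < 1 ->
  (forall q, continuous q -> (forall t, `|q t| <= r) ->
     continuous (F q) /\ (forall t, `|F q t| <= r)) ->
  (forall q q' (e : R), continuous q -> continuous q' ->
     (forall t, `|q t| <= r) -> (forall t, `|q' t| <= r) ->
     (forall t, `|q t - q' t| <= e) ->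
     forall t, `|F q t - F q' t| <= k * e) ->
  exists q, [/\ continuous q, (forall t, `|q t| <= r) & F q = q].
Proof.
move=> r0 /andP[k0 k1] Fr Fk.
pose s i := iter i F (cst 0).
have s_prop i : continuous (s i) /\ (forall t, `|s i t| <= r).
  elim: i => [|i [ih1 ih2]]; last exact: Fr.
  by split=> t; [exact: cst_continuous|rewrite normr0].
have s_dist i j t : `|s (i + j)%N t - s i t| <= k ^+ i * (2 * r).
  elim: i t => [|i ih] t.
    rewrite add0n expr0 mul1r mulr_natl mulr2n.
    have [[_ h1] [_ h2]] := (s_prop j, s_prop 0%N).
    by apply: le_trans (ler_normB _ _) _; rewrite lerD.
  rewrite addSn exprS -mulrA.
  have [[c1 h1] [c2 h2]] := (s_prop (i + j)%N, s_prop i).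
  exact: Fk.
have k_cvg : (fun i => k ^+ i * (2 * r)) @ \oo --> (0 : R).
  rewrite -[X in _ --> X](mul0r (2 * r)); apply: cvgM; last exact: cvg_cst.
  by apply: cvg_expr; rewrite ger0_norm.
have s_cvg t : cvg (s i t @[i --> \oo]).
  apply/cauchy_cvgP/cauchy_exP => e e0.
  have /cvgrPdist_lt/(_ _ e0) [N _ hN] := k_cvg.
  exists (s N t); exists N => // j /= Nj; rewrite -ball_normE/= distrC.
  rewrite -(subnKC Nj); apply: le_lt_trans (s_dist _ _ _) _.
  have := hN N (leqnn N); rewrite /= sub0r normrN ger0_norm//.
  by rewrite !mulr_ge0// exprn_ge0.
pose l t := lim (s i t @[i --> \oo]).
have l_dist i t : `|l t - s i t| <= k ^+ i * (2 * r).
  apply/ler_addgt0Pr => e e0.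
  have /cvgrPdist_lt/(_ _ e0) [N _ hN] := s_cvg t.
  have h1 : `|l t - s (i + N)%N t| < e by apply: hN; exact: leq_addl.
  have h2 := s_dist i N t.
  rewrite -(subrKA (s (i + N)%N t)) (le_trans (ler_normD _ _))//.
  by rewrite addrC lerD// ltW.
have small e : 0 < e -> exists i, k ^+ i * (2 * r) < e.
  move=> e0; have /cvgrPdist_lt/(_ _ e0) [N _ hN] := k_cvg.
  exists N; have := hN N (leqnn N); rewrite /= sub0r normrN ger0_norm//.
  by rewrite !mulr_ge0// exprn_ge0.
have l_cont : continuous l.
  move=> t; apply/cvgrPdist_le => e e0.
  have [i hi] := small _ (divr_gt0 e0 (ltr0Sn R 2)).
  have /cvgrPdist_le/(_ _ (divr_gt0 e0 (ltr0Sn R 2))) := (s_prop i).1 t.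
  apply: filterS => u hu.
  have -> : l t - l u = (l t - s i t) + (s i t - s i u) - (l u - s i u).
    by rewrite opprB !addrA !subrK.
  apply: le_trans (ler_normB _ _) _.
  apply: le_trans (lerD (ler_normD _ _) (lexx _)) _.
  have := l_dist i t; have := l_dist i u; move: hu hi; set x := _ / _.
  have -> : e = 3 * x by rewrite /x mulrC divfK.
  by lra.
have l_r t : `|l t| <= r.
  apply/ler_addgt0Pr => e e0; have [i hi] := small _ e0.
  rewrite -[l t](subrK (s i t)) (le_trans (ler_normD _ _))//.
  have := (s_prop i).2 t; have := l_dist i t; lra.
exists l; split => //; apply/funext => t; apply/eqP; rewrite -subr_eq0 -normr_le0.
apply/ler_addgt0Pr => e e0; have [i hi] := small _ (divr_gt0 e0 (ltr0Sn R 1)).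
have [ci ri] := s_prop i.
have := Fk _ _ _ l_cont ci l_r ri (l_dist i) t.
have := l_dist i.+1 t; rewrite exprS -mulrA => h1 h2.
have -> : F l t - l t = (F l t - F (s i) t) - (l t - s i.+1 t).
  by rewrite opprB addrA subrK.
apply: le_trans (ler_normB _ _) _; rewrite add0r.
have : k * (k ^+ i * (2 * r)) <= k ^+ i * (2 * r).
  by rewrite ler_piMl ?(ltW k1)// !mulr_ge0// exprn_ge0.
have : e = 2 * (e / 2) by rewrite mulrC divfK.
by lra.
Qed.

End contraction.

(** * Extension by constants, primitives *)

Section clamp.
Context {R : realType}.

(** Projection onto the segment. Composition with it turns a function continuous on [[a, b]] into
    one continuous on the whole line, as the primitives and the fixed-point lemma require. *)
Definition clamp (a b t : R) : R := Num.max a (Num.min b t).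

Lemma clamp_itv (a b t : R) : a <= b -> clamp a b t \in `[a, b].
Proof.
by move=> ab; rewrite in_itv/= /clamp le_max lexx/= ge_max ab ge_min lexx.
Qed.

Lemma clamp_id (a b t : R) : t \in `[a, b] -> clamp a b t = t.
Proof.
by rewrite in_itv/= => /andP[at_ tb]; rewrite /clamp min_r// max_r.
Qed.

Lemma clamp_lipschitz (a b s t : R) : `|clamp a b s - clamp a b t| <= `|s - t|.
Proof.
rewrite /clamp !maxEle !minEle.
have := lexx `|s - t|; rewrite ler_norml; move: `|s - t| => n /andP[h1 h2].
by repeat case: ifPn; rewrite -?ltNge => *; rewrite ler_norml; apply/andP; split; lra.
Qed.

Lemma continuous_clamp (a b : R) (V : topologicalType) (g : R -> V) :
  a <= b -> {within `[a, b], continuous g} -> continuous (g \o clamp a b).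
Proof.
move=> ab /subspace_continuousP cg t.
have := cg (clamp a b t) (clamp_itv t ab); apply: cvg_comp => A.
rewrite /within/= !nbhs_simpl /= => /nbhs_ballP[e /= e0 he].
apply/nbhs_ballP; exists e => // s ts.
apply: he; last exact: clamp_itv.
by apply: le_lt_trans ts; exact: clamp_lipschitz.
Qed.

End clamp.

Section primitive.
Context {R : realType} {m n : nat}.
Local Notation mu := (@lebesgue_measure R).
Implicit Types (a t : R) (g h : R -> 'M[R]_(m, n)).

(* The integrals start at [a - 1] so that the derivative at [a] is two-sided. *)
Definition prim (a : R) (g : R -> 'M[R]_(m, n)) (t : R) : 'M[R]_(m, n) :=
  \matrix_(i, j) ((\int[mu]_(s in `[a - 1, t]) g s i j) -
                  (\int[mu]_(s in `[a - 1, a]) g s i j))%R.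

Lemma prim_base a g : prim a g a = 0.
Proof. by apply/matrixP => i j; rewrite !mxE subrr. Qed.

Lemma is_derive_prim a g t : continuous g -> a <= t ->
  is_derive t 1 (prim a g) (g t).
Proof.
move=> cg at_; apply/is_derive_mxP => i j.
have cgij : continuous (fun s => g s i j : R).
  by move=> s; have /continuous_mxP := cg s; exact.
have gint : mu.-integrable `[a - 1, t + 1] (EFin \o (fun s => g s i j)).
  apply: continuous_compact_integrable; first exact: segment_compact.
  exact: continuous_subspaceT.
have [|//||] := @continuous_FTC1_closed _ (fun s => g s i j) (a - 1) t (t + 1) _ gint.
- lra.
- lra.
- exact: cgij.
move=> d1 d2.
pose F x := (\int[mu]_(s in `[a - 1, x]) g s i j)%R.
have dF : is_derive t 1 F (g t i j).
  by apply: DeriveDef; [exact: d1|rewrite -d2 derive1E].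
rewrite (_ : (fun _ => _) = F - cst (F a)); last first.
  by apply/funext => x; rewrite mxE.
by apply: is_derive_eq; rewrite subr0.
Qed.

Lemma prim_norm_le a g (C : R) t : continuous g -> a <= t ->
  (forall s, s \in `[a, t] -> `|g s| <= C) -> `|prim a g t| <= C * (t - a).
Proof.
move=> cg at_ hC; rewrite -[prim a g t]subr0 -(prim_base a g).
apply: mx_lipschitz at_ _ hC => r; rewrite in_itv/= => /andP[ar _].
exact: is_derive_prim.
Qed.

(** Both sides vanish at [a] and have the same derivative from [a] on. *)
Lemma primB a g h t : continuous g -> continuous h -> a <= t ->
  prim a g t - prim a h t = prim a (fun s => g s - h s) t.
Proof.
move=> cg ch at_; apply/eqP; rewrite -subr_eq0 -normr_le0.
have cgh : continuous (fun s => g s - h s).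
  by move=> s; apply: cvgB; [exact: cg|exact: ch].
pose D s := prim a g s - prim a h s - prim a (fun s => g s - h s) s.
have -> : prim a g t - prim a h t - prim a (fun s => g s - h s) t = D t - D a.
  by rewrite /D !prim_base !subr0.
rewrite -[leRHS](mul0r (t - a)).
apply: (mx_lipschitz (dy := fun=> 0)) at_ _ _ => [r|r _]; last by rewrite normr0.
rewrite in_itv/= => /andP[ar _].
have h1 := is_derive_prim cg ar; have h2 := is_derive_prim ch ar.
have h3 := is_derive_prim cgh ar.
have := is_deriveB (is_deriveB h1 h2) h3.
by rewrite subrr.
Qed.

End primitive.

(** * Linear differential equations *)

Section linear_ode.
Context {R : realType}.

Lemma continuous_segment_bounded (V : normedModType R) (g : R -> V) (a b : R) :
  a <= b -> {within `[a, b], continuous g} ->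
  exists2 C : R, 0 < C & forall t, t \in `[a, b] -> `|g t| <= C.
Proof.
move=> ab cg.
have cn : {within `[a, b], continuous (fun t => `|g t|)}.
  by move=> t; apply: cvg_norm; exact: cg.
have [c _ hc] := EVT_max ab cn.
exists (`|g c| + 1); first by rewrite ltr_wpDl.
by move=> t /hc h; apply: le_trans h _; rewrite lerDl.
Qed.

Lemma is_derive_expRM (L a t : R) :
  is_derive t 1 (fun s => expR (L * (s - a))) (L * expR (L * (t - a))).
Proof.
have h : is_derive t 1 (fun s : R => L * (s - a)) L.
  rewrite (_ : (fun _ => _) = L *: (id - cst a)); last exact/funext.
  by apply: is_derive_eq; rewrite subr0 /GRing.scale/= mulr1.
have := @is_derive1_comp _ expR _ t _ _ (is_derive_expR _) h.
by rewrite mulrC.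
Qed.

Lemma continuous_expRM (L a : R) : continuous (fun s => expR (L * (s - a))).
Proof. by move=> t; exact: is_derive_continuous (is_derive_expRM L a t). Qed.

Section weighted_primitive.
Variables (m n : nat) (a L : R).
Hypothesis L0 : 0 < L.
Local Notation w s := (expR (L * (s - a))).
Implicit Types q : R -> 'M[R]_(m, n).

Let wprim q := prim a (fun s => w s *: q s).

Lemma continuous_weight q : continuous q -> continuous (fun s => w s *: q s).
Proof.
by move=> cq t; apply: cvgZ; [exact: continuous_expRM|exact: cq].
Qed.

(** [r / L * w] is a primitive of [r * w], which dominates the integrand. The gain [1 / L] is the
    purpose of the weight. *)
Lemma wprim_norm_le q (r t : R) : continuous q -> a <= t ->
  (forall s, `|q s| <= r) -> `|wprim q t| <= r / L * (w t - 1).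
Proof.
move=> cq at_ qr.
rewrite -[wprim q t]subr0 -(prim_base a (fun s => w s *: q s)).
have := @mx_mean_value _ _ _ (wprim q) (fun s => w s *: q s)
  (fun s => r / L * w s) (fun s => r * w s) a t at_.
rewrite -mulrBr subrr mulr0 expR0; apply => s; rewrite in_itv/= => /andP[as_ _].
- by apply: is_derive_prim => //; exact: continuous_weight.
- apply: is_derive_eq (is_deriveZ (r / L) (is_derive_expRM L a s)) _.
  by rewrite /GRing.scale/= mulrA divfK ?gt_eqF.
- by rewrite normrZ ger0_norm ?expR_ge0// mulrC ler_wpM2r ?expR_ge0.
Qed.

End weighted_primitive.

(* In the norm weighted by [exp (- L (t - a))], integration has norm at most
   [1 / L], which makes the Picard operator a contraction on all of [`[a, b]]. *)
Lemma linear_ode_fundamental n (A : R -> 'M[R]_n) (a b : R) :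
  a <= b -> continuous A ->
  exists X : R -> 'M[R]_n, X a = 1%:M /\
    forall t, t \in `[a, b] -> is_derive t 1 X (A t *m X t).
Proof.
move=> ab cA; have [C C0 AC] := continuous_segment_bounded ab (continuous_subspaceT cA).
(* A matrix product costs a factor [n] in the max norm, so [K] bounds multiplication by [A t]. The
   choice of [L] makes [K / L] at most 1/2 and keeps [L] positive when [K = 0]. *)
pose K := n%:R * C; pose L := 2 * (K + 1).
have K0 : 0 <= K by rewrite mulr_ge0// ltW.
have L0 : 0 < L by rewrite mulr_gt0// ltr_wpDl.
have KL : K / L <= 1 / 2.
  by rewrite ler_pdivrMr// /L mulrA mul1r mulVf ?mul1r ?lerDl.
pose w s := expR (L * (s - a)).
have w_gt0 s : 0 < w s by exact: expR_gt0.
have w_ge1 s : a <= s -> 1 <= w s.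
  by move=> as_; rewrite -[leLHS]expR0 ler_expR mulr_ge0 ?subr_ge0// ltW.
(* The unknown is [q = X' / w], measured in the plain uniform norm; [F q = q] says that [w q = A X]
   on the segment, that is, [X' = A X]. *)
pose X q := fun t => 1%:M + prim a (fun s => w s *: q s) t : 'M[R]_n.
pose F0 q t := (w t)^-1 *: (A t *m X q t).
pose F q := F0 q \o clamp a b.
have cAc : continuous (A \o clamp a b).
  by apply: continuous_clamp => //; exact: continuous_subspaceT.
have dX q t : continuous q -> a <= t -> is_derive t 1 (X q) (w t *: q t).
  move=> cq at_; have := is_deriveD (is_derive_cst (1%:M : 'M[R]_n) t 1)
    (is_derive_prim (continuous_weight (a := a) (L := L) cq) at_).
  by rewrite add0r.
have cF q : continuous q -> continuous (F q).
  move=> cq; apply: continuous_clamp => //.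
  apply/subspace_continuousP => t; rewrite /= in_itv/= => /andP[at_ _].
  apply: cvg_within_filter; apply: cvgZ.
    apply: cvgV; first by rewrite gt_eqF.
    exact: continuous_expRM.
  apply: continuous_mulmx; first exact: cA.
  exact: is_derive_continuous (dX _ _ cq at_).
have Mle t (Y : 'M[R]_n) (y : R) : t \in `[a, b] -> `|Y| <= y * w t ->
    `|(w t)^-1 *: (A t *m Y)| <= K * y.
  move=> tab Yy; have wV : 0 <= (w t)^-1 by rewrite invr_ge0 ltW.
  rewrite normrZ (ger0_norm wV) ler_pdivrMl//.
  apply: le_trans (mulmx_norm_le _ _) _.
  apply: (@le_trans _ _ (K * (y * w t))); last by rewrite mulrA mulrC.
  by rewrite ler_pM ?mulr_ge0// ler_wpM2l// AC.
have [q [cq qr Fq]] : exists q, [/\ continuous q, (forall t, `|q t| <= 2 * K) & F q = q].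
  apply: (@uniform_contraction_fixpoint _ _ _ _ F (2 * K) (1 / 2)).
  - by rewrite mulr_ge0.
  - by apply/andP; split; lra.
  - move=> q cq qr; split; first exact: cF.
    move=> t; rewrite /F/= /F0.
    have ct := clamp_itv t ab; move: (clamp a b t) ct => {}t ct.
    have at_ : a <= t by move: ct; rewrite in_itv/= => /andP[].
    apply: le_trans (Mle _ _ (1 + 2 * K / L) ct _) _; last first.
      have x1 : 2 * K / L <= 1 by rewrite -mulrA; lra.
      by move: (_ / L) x1 => x x1; nra.
    apply: le_trans (ler_normD _ _) _.
    have h1 : `|1%:M : 'M[R]_n| <= 1.
      apply: mx_norm_le => // i j; rewrite mxE.
      by case: (i == j); rewrite ?normr1 ?normr0.
    have h2 := wprim_norm_le L0 cq at_ qr.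
    have h3 := w_ge1 _ at_.
    have h4 : 0 <= 2 * K / L by apply: divr_ge0; [exact: mulr_ge0|exact: ltW].
    apply: le_trans (lerD h1 h2) _; rewrite -/(w t).
    by move: (2 * K / L) (w t) h3 h4 => x y h3 h4; nra.
  - move=> q q' e cq cq' _ _ qq' t; rewrite /F/= /F0.
    have ct := clamp_itv t ab; move: (clamp a b t) ct => {}t ct.
    have at_ : a <= t by move: ct; rewrite in_itv/= => /andP[].
    rewrite -scalerBr -mulmxBr.
    have e0 : 0 <= e := le_trans (normr_ge0 _) (qq' t).
    apply: le_trans (Mle _ _ (e / L) ct _) _; last first.
      by rewrite mulrCA mulrC ler_wpM2r.
    rewrite /X opprD addrACA subrr add0r.
    rewrite primB//; [|exact: continuous_weight|exact: continuous_weight].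
    under [X in prim a X]eq_fun do rewrite -scalerBr.
    have cd : continuous (fun s => q s - q' s).
      by move=> s; apply: cvgB; [exact: cq|exact: cq'].
    apply: le_trans (wprim_norm_le L0 cd at_ qq') _.
    by rewrite ler_wpM2l ?divr_ge0 ?(ltW L0)// lerBlDr lerDl.
exists (X q); split; first by rewrite /X prim_base addr0.
move=> t tab; have at_ : a <= t by move: tab; rewrite in_itv/= => /andP[].
apply: is_derive_eq (dX _ _ cq at_) _.
rewrite (_ : q t = F q t); last by rewrite Fq.
by rewrite /F/= clamp_id// /F0 scalerA divff ?scale1r ?gt_eqF.
Qed.

End linear_ode.

(** * Controllability of the linearized system *)

Section adjoint_pairing.
Context {R : realType}.
Local Notation mu := (@lebesgue_measure R).

Lemma integrable_Rintegral_sum d (T : measurableType d)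
    (nu : {measure set T -> \bar R}) (D : set T) n (h : 'I_n -> T -> R) :
  measurable D -> (forall i, nu.-integrable D (EFin \o h i)) ->
  nu.-integrable D (EFin \o (fun r => \sum_i h i r)) /\
  (\int[nu]_(r in D) (\sum_i h i r) = \sum_i \int[nu]_(r in D) h i r)%R.
Proof.
move=> mD; elim: n h => [|n ih] h hi.
  have -> : (fun r => \sum_i h i r) = cst 0 by apply/funext => r; rewrite big_ord0.
  by split; [exact: integrable0|rewrite big_ord0 Rintegral_cst// mul0r].
have [i1 i2] := ih (fun i => h (widen_ord (leqnSn n) i)) (fun i => hi _).
have -> : (fun r => \sum_i h i r) =
    (fun r => \sum_(i < n) h (widen_ord (leqnSn n) i) r + h ord_max r).
  by apply/funext => r; rewrite big_ord_recr.
split; last by rewrite RintegralD// i2 [RHS]big_ord_recr.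
have := integrableD mD i1 (hi ord_max).
by apply: eq_integrable => // r _; rewrite /= EFinD.
Qed.

(** Turns the increment estimate on [psi x] into a derivative although [x] may fail to have one. *)
Lemma is_derive0_littleo (V : normedModType R) (g : R -> V) (t : R) :
  (forall e : R, 0 < e -> \forall s \near t, `|g s - g t| <= e * `|s - t|) ->
  is_derive t 1 g 0.
Proof.
move=> h.
have c : (fun k : R => k^-1 *: (g (k *: 1 + t) - g t)) @ 0^' --> (0 : V).
  apply/cvgrPdist_le => e e0.
  have /nbhs_ballP[d /= d0 hd] := h e e0.
  near=> k.
  have k0 : k != 0 by near: k; exact: nbhs_dnbhs_neq.
  rewrite sub0r normrN normrZ normfV ler_pdivrMl ?normr_gt0// mulrC.
  have -> : `|k| = `|(k *: 1 + t) - t| by rewrite addrK /GRing.scale/= mulr1.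
  apply: hd; rewrite /ball/= opprD addrCA subrr addr0 normrN /GRing.scale/= mulr1.
  by near: k; exact: dnbhs0_lt.
by apply: DeriveDef; [apply/cvg_ex; exists 0|exact: cvg_lim].
Unshelve. all: by end_near. Qed.

Variables (n p : nat) (t0 t1 : R).
Hypothesis t01 : t0 < t1.
Variables (A : R -> 'M[R]_n) (B : R -> 'M[R]_(n, p)) (psi : R -> 'rV[R]_n).
Hypothesis cA : continuous A.
Hypothesis dpsi : forall t, t \in `[t0, t1] -> is_derive t 1 psi (- (psi t *m A t)).
Hypothesis psiB : forall t, t \in `[t0, t1] -> psi t *m B t = 0.
Variables (x : R -> 'cV[R]_n) (u : R -> 'cV[R]_p).
Hypothesis xu : linear_solution A B t0 t1 x u.

Let F s := A s *m x s + B s *m u s.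
Let e r := \sum_i `|F r i ord0|.
(** [F] stands for [x'] and is only integrable; increments of [E] measure its mass on an interval,
    and they tend to 0 with the interval because [E] is continuous. *)
Let E t := (\int[mu]_(r in `[t0, t]) e r)%R.
Let t01W : t0 <= t1 := ltW t01.

Let e_int : mu.-integrable `[t0, t1] (EFin \o e).
Proof.
have [_ Fi _] := xu.
have [] := @integrable_Rintegral_sum _ _ mu `[t0, t1] n (fun i r => `|F r i ord0|) => //.
by move=> i; have := integrable_norm (Fi i).
Qed.

Let xc : {within `[t0, t1], continuous x}. Proof. by case: xu. Qed.

Let psic : {within `[t0, t1], continuous psi}.
Proof. by apply: derivable_within_continuous => t /dpsi[]. Qed.

(** With [K] the primitive of [psi A x], the increment splits in two. In
    [(psi t - psi s) x t + (K t - K s)] the equation of [psi] leaves the integral of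
    [psi r A r (x r - x t)]. In [psi s (x t - x s) - (K t - K s)], since [psi B = 0] gives
    [psi F = psi A x], there remains the integral of [(psi s - psi r) F r], and [psi] is Lipschitz.
    Each part is [t - s] times a quantity that is small for close times. *)
Lemma adjoint_pairing_estimate : exists2 C : R, 0 < C &
  forall s t (w : R), t0 <= s -> s <= t -> t <= t1 ->
  (forall r, r \in `[s, t] -> `|x r - x t| <= w) ->
  `|psi t *m x t - psi s *m x s| <= C * (t - s) * (w + (E t - E s)).
Proof.
have [_ Fi xE] := xu.
pose al r := psi r *m A r.
pose k := (fun r => al r *m x r) \o clamp t0 t1.
have alc : {within `[t0, t1], continuous al}.
  move=> r; apply: continuous_mulmx; first exact: psic.
  exact: continuous_subspaceT.
have kc : continuous k.
  by apply: continuous_clamp => // r; apply: continuous_mulmx; [exact: alc|exact: xc].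
have [C C0 alC] := continuous_segment_bounded t01W alc.
pose K := prim t0 k.
(* [n C] comes from the matrix product in the first part; one more [C] pays for the second. *)
exists (n.+1%:R * C); first by rewrite mulr_gt0.
move=> s t w ts st tt xw.
have sub r : r \in `[s, t] -> r \in `[t0, t1].
  by rewrite !in_itv/= => /andP[h1 h2]; rewrite (le_trans ts)// (le_trans h2).
have sI : s \in `[t0, t1] by apply: sub; rewrite in_itv/= lexx.
have tI : t \in `[t0, t1] by apply: sub; rewrite in_itv/= lexx st.
have w0 : 0 <= w.
  by apply: le_trans (xw t _); rewrite ?normr_ge0// in_itv/= lexx st.
have first_term : `|(psi t *m x t + K t) - (psi s *m x t + K s)| <=
    n%:R * C * w * (t - s).
  have dK r : r \in `[s, t] ->
      is_derive r 1 (fun q => psi q *m x t + K q) (- al r *m x t + k r).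
    move=> rI; have r0 : t0 <= r by have := sub _ rI; rewrite in_itv/= => /andP[].
    exact: is_deriveD (is_derive_mulmxr _ (dpsi (sub _ rI))) (is_derive_prim kc r0).
  apply: (mx_lipschitz st dK) => r rI.
  rewrite /k/= clamp_id; last exact: sub.
  rewrite mulNmx addrC -mulmxBr (le_trans (mulmx_norm_le _ _))//.
  by rewrite ler_pM ?mulr_ge0// ?xw// ler_wpM2l// alC//; exact: sub.
have mst : measurable (`]s, t] : set (measurableTypeR R)) by exact: measurable_itv.
have sub_itv a : a \in `[t0, t1] -> `[t0, a] `<=` `[t0, t1].
  by rewrite in_itv/= => /andP[_ h]; exact: subset_itvl.
have intS (h : R -> R) : mu.-integrable `[t0, t1] (EFin \o h) ->
    mu.-integrable `[t0, t] (EFin \o h) /\ mu.-integrable `]s, t] (EFin \o h).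
  move=> hi; split; first by apply: integrableS hi => //; exact: sub_itv.
  apply: integrableS hi => // r /= rI; apply: sub.
  exact: subset_itv_oc_cc rI.
have intB (h : R -> R) : mu.-integrable `[t0, t1] (EFin \o h) ->
    (\int[mu]_(r in `[t0, t]) h r - \int[mu]_(r in `[t0, s]) h r =
     \int[mu]_(r in `]s, t]) h r)%R.
  by move=> /intS[hi _]; rewrite Rintegral_itvB// bnd_simp.
have xst i : x t i ord0 - x s i ord0 = (\int[mu]_(r in `]s, t]) F r i ord0)%R.
  by rewrite (xE t tI i) (xE s sI i) opprD addrACA subrr add0r;
  exact: (intB (fun r => F r i ord0) (Fi i)).
have kint a b : mu.-integrable `[a, b] (EFin \o (fun r => k r ord0 ord0)).
  apply: continuous_compact_integrable; first exact: segment_compact.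
  apply: continuous_subspaceT => r.
  by have /continuous_mxP := kc r; exact.
have Kst : (K t - K s) ord0 ord0 = (\int[mu]_(r in `]s, t]) k r ord0 ord0)%R.
  rewrite !mxE opprB addrA subrK Rintegral_itvB//; rewrite bnd_simp//.
  by rewrite (le_trans _ ts)// gerBl.
have Est : E t - E s = (\int[mu]_(r in `]s, t]) e r)%R by exact: intB.
have second_term : `|psi s *m (x t - x s) - (K t - K s)| <=
    C * (t - s) * (E t - E s).
  have E0 : 0 <= E t - E s.
    by rewrite Est; apply: Rintegral_ge0 => r _; exact: sumr_ge0.
  apply: mx_norm_le => [|i j]; first by rewrite !mulr_ge0// ?subr_ge0// ltW.
  rewrite !ord1 {i j} mxE [X in _ + X]mxE Kst mxE.
  have hint i : mu.-integrable `]s, t] (EFin \o (fun r => psi s ord0 i * F r i ord0)).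
    have := integrableZl mst (psi s ord0 i) (intS _ (Fi i)).2.
    by apply: eq_integrable => // r _; rewrite /= EFinM.
  have [i1 i2] := integrable_Rintegral_sum mst hint.
  have -> : \sum_j psi s ord0 j * (x t - x s) j ord0 =
      (\int[mu]_(r in `]s, t]) (\sum_j psi s ord0 j * F r j ord0))%R.
    rewrite i2; apply: eq_bigr => j _; rewrite 2!mxE xst RintegralZl//.
    exact: (intS _ (Fi j)).2.
  have ki := (intS _ (kint t0 t1)).2.
  rewrite -RintegralB//.
  have Ji : mu.-integrable `]s, t]
      (EFin \o (fun r => \sum_j psi s ord0 j * F r j ord0 - k r ord0 ord0)).
    have := integrableB mst i1 ki.
    by apply: eq_integrable => // r _; rewrite /= EFinB.
  apply: le_trans (le_normr_Rintegral mst Ji) _.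
  have ei := (intS _ e_int).2.
  rewrite Est -RintegralZl//; apply: le_Rintegral => //.
  - by have := integrable_norm Ji.
  - have := integrableZl mst (C * (t - s)) ei.
    by apply: eq_integrable => // r _; rewrite /= EFinM.
  move=> r rst.
  have rI : r \in `[s, t] by exact: subset_itv_oc_cc rst.
  have rI' := sub _ rI.
  have -> : \sum_j psi s ord0 j * F r j ord0 - k r ord0 ord0 =
      ((psi s - psi r) *m F r) ord0 ord0.
    have -> : k r = psi r *m F r.
      by rewrite /k/= clamp_id// /F mulmxDr !mulmxA psiB// mul0mx addr0.
    by rewrite mulmxBl [RHS]mxE [X in _ = _ + X]mxE; congr (_ - _); rewrite mxE.
  rewrite mxE (le_trans (ler_norm_sum _ _ _))// mulr_sumr ler_sum// => j _.
  rewrite normrM ler_wpM2r// (le_trans (mx_entry_le _ _ _))// distrC.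
  move: rI; rewrite in_itv/= => /andP[sr rt].
  apply: (@le_trans _ _ (C * (r - s))); last by rewrite ler_wpM2l ?(ltW C0)// lerB.
  have sub' q : q \in `[s, r] -> q \in `[t0, t1].
    rewrite in_itv/= => /andP[sq qr]; apply: sub.
    by rewrite in_itv/= sq (le_trans qr).
  have dq q : q \in `[s, r] -> is_derive q 1 psi (- al q) by move=> /sub'/dpsi.
  by apply: (mx_lipschitz sr dq) => q /sub'/alC; rewrite normrN.
have -> : psi t *m x t - psi s *m x s =
   ((psi t *m x t + K t) - (psi s *m x t + K s)) +
   (psi s *m (x t - x s) - (K t - K s)).
  by rewrite mulmxBr; apply/matrixP => i j; rewrite !mxE; ring.
apply: le_trans (ler_normD _ _) (le_trans (lerD first_term second_term) _).
have E0 : 0 <= E t - E s.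
  by rewrite Est; apply: Rintegral_ge0 => r _; exact: sumr_ge0.
rewrite -natr1.
have d0 : 0 <= C * (t - s) by rewrite mulr_ge0 ?subr_ge0// ltW.
have n0 : 0 <= (n%:R : R) by [].
rewrite -subr_ge0.
have -> : (n%:R + 1) * C * (t - s) * (w + (E t - E s)) -
  (n%:R * C * w * (t - s) + C * (t - s) * (E t - E s)) =
  n%:R * (C * (t - s)) * (E t - E s) + (C * (t - s)) * w by ring.
by apply: addr_ge0; apply: mulr_ge0 => //; exact: mulr_ge0.
Qed.

(** Divided by [t - s], the estimate tends to 0, so the derivative vanishes at interior times;
    continuity up to the ends and the mean value theorem conclude. *)
Lemma adjoint_pairing_const : psi t1 *m x t1 = psi t0 *m x t0.
Proof.
have [C C0 est] := adjoint_pairing_estimate.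
pose g t := psi t *m x t.
have gc : {within `[t0, t1], continuous g}.
  by move=> t; apply: continuous_mulmx; [exact: psic|exact: xc].
have Ec : {within `[t0, t1], continuous E}.
  exact: parameterized_integral_continuous.
have dg t : t \in `]t0, t1[ -> is_derive t 1 g 0.
  move=> tI; apply: is_derive0_littleo => eps eps0.
  have [xt Et] : {for t, continuous x} /\ {for t, continuous E}.
    by split; apply: within_continuous_continuous tI.
  (* When [t <= s], passing from [x r] to [x s] through [x t] costs [2 d] and the increment of [E]
     costs [d]; the factor 4 leaves a margin. *)
  pose d := eps / (4 * C).
  have d0 : 0 < d by rewrite divr_gt0// mulr_gt0.
  have /cvgrPdist_le/(_ _ d0)/nbhs_ballP[a /= a0 xa] := xt.
  have /cvgrPdist_le/(_ _ d0)/nbhs_ballP[b /= b0 Eb] := Et.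
  near=> s.
  have sI : s \in `]t0, t1[ by near: s; exact: near_in_itvoo.
  have sa : `|t - s| < a by near: s; exact: nbhsx_ballx.
  have sb : `|t - s| < b by near: s; exact: nbhsx_ballx.
  have Ets : `|E t - E s| <= d by exact: Eb.
  have close r : `|t - r| <= `|t - s| -> `|x t - x r| <= d.
    by move=> rs; apply: xa; exact: le_lt_trans rs sa.
  have := tI; have := sI; rewrite !in_itv/= => /andP[t0s st1] /andP[t0t tt1].
  have bound q q' : `|E q' - E q| <= d -> 0 <= q' - q ->
      C * (q' - q) * (2 * d + (E q' - E q)) <= eps * (q' - q).
    move=> hE q0; apply: (@le_trans _ _ (C * (q' - q) * (4 * d))).
      rewrite ler_wpM2l//; first by rewrite mulr_ge0// ltW.
      by have := ler_norm (E q' - E q); lra.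
    rewrite [leLHS](_ : _ = (4 * C * d) * (q' - q)); last by ring.
    by rewrite /d [4 * C * _]mulrC divfK// gt_eqF// mulr_gt0.
  have [ts|st] := leP t s.
  - rewrite (ger0_norm (_ : 0 <= s - t)) ?subr_ge0//.
    apply: le_trans (bound _ _ _ _); [|by rewrite distrC|by rewrite subr_ge0].
    apply: est; [exact: ltW|by []|exact: ltW|] => r; rewrite in_itv/= => /andP[tr rs].
    rewrite -(subrKA (x t)) (le_trans (ler_normD _ _))//.
    rewrite mulr_natl mulr2n lerD//; last exact: close.
    rewrite distrC close// distrC [leRHS]distrC !ger0_norm ?subr_ge0//.
    by rewrite lerD2r.
  - rewrite distrC [`|s - t|]distrC (ger0_norm (_ : 0 <= t - s)) ?subr_ge0 ?(ltW st)//.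
    apply: le_trans (bound _ _ _ _); [|by []|by rewrite subr_ge0 ltW].
    apply: est; [exact: ltW|exact: ltW|exact: ltW|] => r; rewrite in_itv/= => /andP[sr rt].
    apply: (@le_trans _ _ d); last by lra.
    by rewrite distrC close// !ger0_norm ?subr_ge0 ?(ltW st)// lerD2l lerN2.
apply/matrixP => i j; rewrite !ord1 {i j}.
have dg00 t : t \in `]t0, t1[ -> is_derive t 1 (fun s => g s ord0 ord0) 0.
  by move=> /dg/is_derive_mxP/(_ ord0 ord0); rewrite mxE.
have gc00 : {within `[t0, t1], continuous (fun s => g s ord0 ord0)}.
  by move=> s; have /continuous_mxP := gc s; exact.
have [c _] := MVT_segment t01W dg00 gc00.
by rewrite mul0r => /eqP; rewrite subr_eq0 => /eqP.
Unshelve. all: by end_near. Qed.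

End adjoint_pairing.

(** * Derivatives relative to a segment *)

Section derivative_within.
Context {R : realType}.

(** A [lim] is determined only along a proper filter; here, no point of a nondegenerate segment is
    isolated in it. This gives [derive_in] its value, ends included. *)
Lemma within_dnbhs_proper (a b t : R) : a < b -> t \in `[a, b] ->
  ProperFilter (within `[a, b] t^').
Proof.
move=> ab; rewrite in_itv/= => /andP[at_ tb].
apply: Build_ProperFilter_ex => A.
rewrite /within/= => -[/= e e0 eA].
have pick s : `|t - s| < e -> s != t -> a <= s -> s <= b -> exists x, A x.
  by move=> ts st as_ sb; exists s; apply: eA => //=; rewrite in_itv/= as_.
have [ltb|bt] := ltP t b.
- pose m := Num.min (e / 2) (b - t).
  have m0 : 0 < m by rewrite lt_min divr_gt0//= subr_gt0.
  have me : m <= e / 2 by rewrite ge_min lexx.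
  have mb : m <= b - t by rewrite ge_min lexx orbT.
  apply: (pick (t + m)); [|by rewrite gt_eqF ?ltrDl|by lra|by lra].
  by rewrite opprD addrA subrr sub0r normrN gtr0_norm//; lra.
- pose m := Num.min (e / 2) (t - a).
  have m0 : 0 < m by rewrite lt_min divr_gt0//= subr_gt0 (lt_le_trans ab).
  have me : m <= e / 2 by rewrite ge_min lexx.
  have mb : m <= t - a by rewrite ge_min lexx orbT.
  apply: (pick (t - m)); [|by rewrite lt_eqF// gtrBl|by lra|by lra].
  by rewrite opprB addrC subrK gtr0_norm//; lra.
Qed.

Lemma is_derive_diff_quot (V : normedModType R) (D : set R) (g : R -> V)
    (t : R) dg :
  is_derive t 1 g dg -> diff_quot g t s @[s --> within D t^'] --> dg.
Proof.
move=> [dg1 <-]; apply/cvgrPdist_le => e e0.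
have /cvgrPdist_le/(_ _ e0)[/= d d0 hd] := dg1.
exists d => // s /= ts st _.
have := hd (s - t); rewrite /= /ball_/= sub0r normrN distrC subr_eq0 => /(_ ts st).
by rewrite /diff_quot /GRing.scale/= mulr1 subrK.
Qed.

(** Nothing is known of [g] outside the segment, yet at an end the two-sided derivative can be read
    off from the inner side. *)
Lemma derivative_of_constant (V : normedModType R) (g : R -> V) (a b t : R) dg :
  a < b -> (forall s, s \in `[a, b] -> g s = g a) -> t \in `[a, b] ->
  is_derive t 1 g dg -> dg = 0.
Proof.
move=> ab gc tI dgt; have pf := within_dnbhs_proper ab tI.
rewrite -(cvg_lim (@norm_hausdorff _ V) (is_derive_diff_quot `[a, b] dgt)).
apply: cvg_lim => //.
apply: cvg_near_cst; exists 1 => //= s _ _ sI.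
by rewrite /diff_quot (gc _ sI) (gc _ tI) subrr scaler0.
Qed.

(** Equal end values force the monotone [g] to be constant. This stands in for the vanishing of a
    continuous nonnegative function of zero integral. *)
Lemma derivative_ge0_cst (g dg : R -> R) (a b : R) : a < b ->
  (forall s, s \in `[a, b] -> is_derive s 1 g (dg s)) ->
  (forall s, s \in `[a, b] -> 0 <= dg s) -> g b = g a ->
  forall s, s \in `[a, b] -> dg s = 0.
Proof.
move=> ab hg dg0 gab s sI; have abW := ltW ab.
apply: derivative_of_constant ab _ sI (hg _ sI).
have mono u v : u \in `[a, b] -> v \in `[a, b] -> u <= v -> g u <= g v.
  move=> + + uv; rewrite !in_itv/= => /andP[au ub] /andP[av vb].
  have sub r : r \in `[u, v] -> r \in `[a, b].
    by rewrite !in_itv/= => /andP[ur rv]; rewrite (le_trans au)//= (le_trans rv).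
  have goo r : r \in `]u, v[ -> is_derive r 1 g (dg r).
    by move=> rI; apply: hg; apply: sub; exact: subset_itv_oo_cc rI.
  have gc : {within `[u, v], continuous g}.
    by apply: derivable_within_continuous => r /sub/hg[].
  have [c cI e] := MVT_segment uv goo gc.
  by rewrite -subr_ge0 e mulr_ge0 ?subr_ge0// dg0//; exact: sub.
move=> r rI; have := rI; rewrite in_itv/= => /andP[ar rb].
have aI : a \in `[a, b] by rewrite in_itv/= lexx abW.
have bI : b \in `[a, b] by rewrite in_itv/= lexx abW.
by apply/le_anti/andP; split; [rewrite -gab|]; exact: mono.
Qed.

End derivative_within.

Lemma mx_derive0_cst {R : realType} m n (g : R -> 'M[R]_(m, n)) (a b : R) :
  (forall s, s \in `[a, b] -> is_derive s 1 g 0) ->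
  forall s, s \in `[a, b] -> g s = g a.
Proof.
move=> hg s; rewrite in_itv/= => /andP[as_ sb].
have sub r : r \in `[a, s] -> is_derive r 1 g ((fun=> 0) r).
  by rewrite in_itv/= => /andP[ar rs]; apply: hg; rewrite in_itv/= ar (le_trans rs).
apply/eqP; rewrite -subr_eq0 -normr_le0 -(mul0r (s - a)).
by apply: (mx_lipschitz as_ sub) => r _; rewrite normr0.
Qed.

Lemma trmx_mul_eq0 {R : realType} m (v : 'cV[R]_m) :
  (v^T *m v) ord0 ord0 = 0 -> v = 0.
Proof.
rewrite mxE => /eqP; rewrite psumr_eq0 => [|i _]; last first.
  by rewrite mxE -expr2 sqr_ge0.
move=> /allP h; apply/matrixP => i j; rewrite ord1 mxE.
have := h i (mem_index_enum i); rewrite mxE -expr2 sqrf_eq0 => /eqP.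
by [].
Qed.

(** * A finite-dimensional family of C^1 controls *)

Section control_family.
Context {R : realType} {n p : nat}.
Variables (t0 t1 : R) (A : R -> 'M[R]_n) (B : R -> 'M[R]_(n, p)).
Hypothesis t01 : t0 < t1.
Hypotheses (cA : continuous A) (cB : continuous B).
Variables (Phi Psi : R -> 'M[R]_n).
Hypotheses (Phi0 : Phi t0 = 1%:M) (Psi0 : Psi t0 = 1%:M).
Hypothesis dPhi : forall t, t \in `[t0, t1] -> is_derive t 1 Phi (A t *m Phi t).
Hypothesis dPsi : forall t, t \in `[t0, t1] ->
  is_derive t 1 Psi (- (Psi t *m A t)).

Lemma PsiPhi t : t \in `[t0, t1] -> Psi t *m Phi t = 1%:M.
Proof.
have d0 s : s \in `[t0, t1] -> is_derive s 1 (fun r => Psi r *m Phi r) 0.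
  move=> sI; have := is_derive_mulmx (dPsi sI) (dPhi sI).
  by rewrite mulNmx mulmxA addNr.
by move=> tI; rewrite (mx_derive0_cst d0 tI)/= Phi0 Psi0 mulmx1.
Qed.

Hypothesis AB_controllable : linear_controllable A B t0 t1.

(* The weights [W] solve [W'' = - (Psi B)^T], [W t0 = 0], [W' t1 = 0]; then
   [v P(t1) v^T = \int |W' v^T|^2], as for the controllability Gramian, but
   with controls [W] that are of class C^1. *)
Lemma C1_control_family : exists (W dW : R -> 'M[R]_(p, n)) (P : R -> 'M[R]_n),
  [/\ continuous dW,
      W t0 = 0 /\ P t0 = 0,
      forall t, t0 <= t -> is_derive t 1 W (dW t),
      forall t, t \in `[t0, t1] -> is_derive t 1 P (Psi t *m B t *m W t) &
      P t1 \in unitmx].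
Proof.
have t01W := ltW t01.
have t0I : t0 \in `[t0, t1] by rewrite in_itv/= lexx.
have t1I : t1 \in `[t0, t1] by rewrite in_itv/= lexx andbT.
pose M := (fun t => Psi t *m B t) \o clamp t0 t1.
have Mc : continuous M.
  apply: continuous_clamp => // t; apply: continuous_mulmx.
    by apply: derivable_within_continuous => s /dPsi[].
  exact: continuous_subspaceT.
have MTc : continuous (fun t => (M t)^T) by move=> t; apply: continuous_trmx; exact: Mc.
pose S := prim t0 (fun t => (M t)^T).
have dS t : t0 <= t -> is_derive t 1 S (M t)^T by exact: is_derive_prim.
pose dW := (fun t => S t1 - S t) \o clamp t0 t1.
have dWE t : t \in `[t0, t1] -> dW t = S t1 - S t by move=> tI; rewrite /dW/= clamp_id.
have dWc : continuous dW.
  apply: continuous_clamp => //; apply: derivable_within_continuous => t.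
  rewrite in_itv/= => /andP[tt0 _].
  by have [] := is_deriveB (is_derive_cst (S t1) t 1) (dS _ tt0).
pose W := prim t0 dW.
have dWW t : t0 <= t -> is_derive t 1 W (dW t) by exact: is_derive_prim.
have Wc : {within `[t0, t1], continuous W}.
  apply: derivable_within_continuous => t.
  by rewrite in_itv/= => /andP[tt0 _]; have [] := dWW _ tt0.
pose k := (fun t => M t *m W t) \o clamp t0 t1.
have kc : continuous k.
  apply: continuous_clamp => // t; apply: continuous_mulmx; last exact: Wc.
  exact: continuous_subspaceT.
pose P := prim t0 k.
have dP t : t \in `[t0, t1] -> is_derive t 1 P (Psi t *m B t *m W t).
  move=> tI; have := tI; rewrite in_itv/= => /andP[tt0 _].
  have := is_derive_prim kc tt0.
  by rewrite /k/= clamp_id// /M/= clamp_id.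
exists W, dW, P; split => //; first by rewrite /W /P !prim_base.
rewrite -row_free_unit -kermx_eq0; apply/rowV0P => v /sub_kermxP vP.
pose c := v^T.
have dWv : forall t, t \in `[t0, t1] -> dW t *m c = 0.
  pose g t := (S t1 - S t) *m c.
  have dg t : t \in `[t0, t1] -> is_derive t 1 g (- (M t)^T *m c).
    rewrite in_itv/= => /andP[tt0 _]; apply: is_derive_mulmxr.
    by have := is_deriveB (is_derive_cst (S t1) t 1) (dS _ tt0); rewrite sub0r.
  pose Q t := v *m P t *m c + (g t)^T *m (W t *m c).
  have dQ t : t \in `[t0, t1] -> is_derive t 1 Q ((dW t *m c)^T *m (dW t *m c)).
    move=> tI; have := tI; rewrite in_itv/= => /andP[tt0 _].
    have h1 := is_derive_mulmxr c (is_derive_mulmxl v (dP _ tI)).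
    have h2 := is_derive_mulmx (is_derive_trmx (dg _ tI))
                 (is_derive_mulmxr c (dWW _ tt0)).
    apply: is_derive_eq (is_deriveD h1 h2) _; rewrite /g -dWE//.
    have -> : (- (M t)^T *m c)^T = - (v *m (Psi t *m B t)).
      by rewrite mulNmx linearN/= trmx_mul trmxK /c trmxK /M/= clamp_id.
    by rewrite mulNmx !mulmxA addrA subrr add0r.
  have Q0 t : t \in `[t0, t1] -> is_derive t 1 (fun s => Q s ord0 ord0)
      (((dW t *m c)^T *m (dW t *m c)) ord0 ord0).
    by move=> /dQ/is_derive_mxP; exact.
  move=> t tI; apply: trmx_mul_eq0; move: t tI.
  apply: (derivative_ge0_cst t01 Q0) => [t _|].
    by rewrite mxE sumr_ge0// => i _; rewrite [_^T _ _]mxE -expr2 sqr_ge0.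
  by rewrite /Q /g vP mul0mx subrr mul0mx trmx0 mul0mx /W /P !prim_base
    mulmx0 mul0mx mul0mx mulmx0.
(* [W' c = 0] makes [S c] constant, so its derivative [M^T c] is 0. *)
have vM t : t \in `[t0, t1] -> v *m Psi t *m B t = 0.
  move=> tI; have := tI; rewrite in_itv/= => /andP[tt0 _].
  have SE s : s \in `[t0, t1] -> S s *m c = S t0 *m c.
    move=> sI; apply/eqP; rewrite -subr_eq0 -mulmxBl.
    have -> : S s - S t0 = dW t0 - dW s.
      by rewrite (dWE _ sI) (dWE _ t0I) opprB [RHS]addrC subrKA.
    by rewrite mulmxBl (dWv _ t0I) (dWv _ sI) subrr.
  have dSc := is_derive_mulmxr c (dS _ tt0).
  have := derivative_of_constant t01 SE tI dSc.
  move=> /(congr1 trmx); rewrite trmx_mul trmxK /c trmxK trmx0 /M/= clamp_id//.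
  by rewrite mulmxA.
have dpsi t : t \in `[t0, t1] ->
    is_derive t 1 (fun s => v *m Psi s) (- (v *m Psi t *m A t)).
  by move=> tI; have := is_derive_mulmxl v (dPsi tI); rewrite mulmxN mulmxA.
(* Steering from 0 to [Phi(t1) v^T] makes the pairing 0 at [t0] and [v Psi(t1) Phi(t1) v^T = v v^T]
   at [t1]. *)
have [u [_ [x [xu x0 x1]]]] := AB_controllable 0 (Phi t1 *m c).
have := adjoint_pairing_const t01 cA dpsi vM xu.
rewrite x0 x1 mulmx0 -mulmxA [Psi t1 *m _]mulmxA PsiPhi// mul1mx => h.
apply: (can_inj (@trmxK _ _ _)); rewrite trmx0; apply: trmx_mul_eq0.
by rewrite trmxK h mxE.
Qed.

End control_family.

(** * First-order expansion along a compact curve *)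

Section differential_coordinates.
Context {R : realType}.

Lemma linear_pair_coordE (n p m : nat)
    (L : {linear ('cV[R]_n * 'cV[R]_p)%type -> 'cV[R]_m}) z w :
  L (z, w) = (\matrix_(i, j) L (delta_mx j ord0, 0) i ord0) *m z +
             (\matrix_(i, j) L (0, delta_mx j ord0) i ord0) *m w.
Proof.
have -> : (z, w) = \sum_j z j ord0 *: (delta_mx j ord0, 0) +
                   \sum_j w j ord0 *: (0, delta_mx j ord0).
  rewrite [LHS]surjective_pairing [RHS]surjective_pairing; congr pair => /=.
  - rewrite !(big_morph fst (fun _ _ => erefl) erefl)/=.
    rewrite [X in _ + X]big1 ?addr0 => [|j _]; last by rewrite scaler0.
    rewrite {1}[z]matrix_sum_delta; apply: eq_bigr => j _.
    by rewrite big_ord_recl big_ord0 addr0.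
  - rewrite !(big_morph snd (fun _ _ => erefl) erefl)/=.
    rewrite [X in X + _]big1 ?add0r => [|j _]; last by rewrite scaler0.
    rewrite {1}[w]matrix_sum_delta; apply: eq_bigr => j _.
    by rewrite big_ord_recl big_ord0 addr0.
rewrite linearD !linear_sum/=; congr (_ + _).
  apply/matrixP => i j; rewrite !ord1 mxE summxE; apply: eq_bigr => l _.
  by rewrite linearZ !mxE mulrC.
apply/matrixP => i j; rewrite !ord1 mxE summxE; apply: eq_bigr => l _.
by rewrite linearZ !mxE mulrC.
Qed.

(** A partial derivative is taken along an affine inclusion [i]; the difference quotients coincide,
    so partials become directional derivatives of [f], hence values of its differential. *)
Lemma derive_affine (U V W : normedModType R) (f : V -> W) (i : U -> V) x d e :
  (forall h : R, i (h *: d + x) = h *: e + i x) ->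
  'D_d (f \o i) x = 'D_e f (i x).
Proof.
move=> hi; rewrite /derive.
have -> // : (fun h : R => h^-1 *: (((f \o i) \o shift x) (h *: d) - (f \o i) x)) =
  (fun h : R => h^-1 *: ((f \o shift (i x)) (h *: e) - f (i x))).
by apply/funext => h /=; rewrite hi.
Qed.

Variables (n p : nat) (f : 'cV[R]_n * 'cV[R]_p -> 'cV[R]_n).

Lemma jac_xE x u i j : differentiable f (x, u) ->
  jac_x f x u i j = 'd f (x, u) (delta_mx j ord0, 0) i ord0.
Proof.
move=> df; rewrite mxE -(deriveE _ df).
rewrite -(@derive_affine _ _ _ f (fun y => (y, u)) x (delta_mx j ord0))// => h.
by congr pair; rewrite /= scaler0 add0r.
Qed.

Lemma jac_uE x u i j : differentiable f (x, u) ->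
  jac_u f x u i j = 'd f (x, u) (0, delta_mx j ord0) i ord0.
Proof.
move=> df; rewrite mxE -(deriveE _ df).
rewrite -(@derive_affine _ _ _ f (fun y => (x, y)) u (delta_mx j ord0))// => h.
by congr pair; rewrite /= scaler0 add0r.
Qed.

Lemma diff_jacE x u z w : differentiable f (x, u) ->
  'd f (x, u) (z, w) = jac_x f x u *m z + jac_u f x u *m w.
Proof.
move=> df; rewrite linear_pair_coordE; congr (_ + _); congr (_ *m _).
  by apply/matrixP => i j; rewrite mxE jac_xE.
by apply/matrixP => i j; rewrite mxE jac_uE.
Qed.

End differential_coordinates.

Section C1_on_compact.
Context {R : realType} {V : normedModType R} {m n : nat}.
Variables (Om : set V) (f : V -> 'M[R]_(m, n)).
Hypotheses (hOm : open Om) (hf : C1_open Om f).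

Lemma cvg_diff_along (T : Type) (F : set_system T) {FF : Filter F} (c : T -> V)
    (z v : V) :
  c s @[s --> F] --> z -> Om z -> 'd f (c s) v @[s --> F] --> 'd f z v.
Proof.
move=> cz Oz; apply/cvgrPdist_le => e e0.
have k0 : 0 < e / (`|v| + 1) by rewrite divr_gt0// ltr_wpDl.
have := cz _ (hf.2 _ Oz _ k0); rewrite nbhs_simpl /=.
apply: filterS => s /(_ v); rewrite distrC => h; apply: le_trans h _.
by rewrite mulrAC ler_pdivrMr ?ltr_wpDl// ler_wpM2l ?lerDl// ltW.
Qed.

Lemma is_derive_along (a d : V) (s : R) : differentiable f (a + s *: d) ->
  is_derive s 1 (fun r => f (a + r *: d)) ('d f (a + s *: d) d).
Proof.
move=> df.
have e : (fun h : R =>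
      h^-1 *: (((fun r => f (a + r *: d)) \o shift s) (h *: 1) - f (a + s *: d)))
    = (fun h : R => h^-1 *: ((f \o shift (a + s *: d)) (h *: d) - f (a + s *: d))).
  apply/funext => h /=; congr (_ *: (f _ - _)).
  by rewrite [h *: 1]mulr1 scalerDl addrCA.
apply: DeriveDef; first by rewrite /derivable e; exact: diff_derivable.
by rewrite -(deriveE _ df) /derive e.
Qed.

(** On the segment from [c t + w] to [c t + v], the map [f - 'd f (c t)] has a differential of norm
    at most [k], and the mean value inequality applies. Compactness of [[a, b]] makes the radius
    independent of [t]. *)
Lemma C1_remainder_lipschitz (c : R -> V) (a b k : R) :
  {within `[a, b], continuous c} -> (forall t, t \in `[a, b] -> Om (c t)) ->
  0 < k -> exists2 r : R, 0 < r & forall t, t \in `[a, b] ->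
    (forall v, `|v| <= r -> Om (c t + v)) /\
    (forall v w, `|v| <= r -> `|w| <= r ->
      `|f (c t + v) - f (c t + w) - 'd f (c t) (v - w)| <= k * `|v - w|).
Proof.
move=> /subspace_continuousP cc cOm k0.
(* Membership of [t] is put inside [Q] so that the covering argument can use full neighbourhoods in
   [R], while [c] is controlled on the segment only. *)
pose Q (r t : R) := t \in `[a, b] -> forall z, `|z - c t| <= r ->
  Om z /\ forall v, `|'d f z v - 'd f (c t) v| <= k * `|v|.
have [r r0 Qr] : exists2 r : R, 0 < r & forall t, t \in `[a, b] -> Q r t.
  have near_Q : \forall r \near (0 : R)^'+, `[a, b] `<=` Q r.
    apply: (compact_near_coveringP _).1 (@segment_compact _ a b) _ _ _ _ _ => t tI.
    have Oct := cOm _ tI.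
    have [d /= d0 dOm] := (nbhs_ballP _ _).1 (open_nbhs_nbhs (conj hOm Oct)).
    have [e /= e0 edf] := (nbhs_ballP _ _).1 (hf.2 _ Oct _ (divr_gt0 k0 (ltr0Sn R 1))).
    (* A point within [h] of [c s], itself within [h] of [c t], stays in both balls. The
       differentials at [z] and [c s] are compared through the one at [c t], whence [k / 2]
       twice. *)
    pose h := Num.min d e / 2.
    have h0 : 0 < h by rewrite divr_gt0// lt_min d0.
    have hd : h + h <= d by rewrite -splitr ge_min lexx.
    have he : h + h <= e by rewrite -splitr ge_min lexx orbT.
    have /cvgrPdist_lt/(_ _ h0) := cc _ tI.
    rewrite near_withinE => ct.
    exists ([set s | s \in `[a, b] -> `|c t - c s| < h], [set r | r < h]).
      by split => //=; exact: nbhs_right_lt.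
    move=> [s r] [/= sc rh] sI z zr.
    have zt : `|c t - z| < h + h.
      rewrite -(subrKA (c s)) (le_lt_trans (ler_normD _ _))// ltrD// ?sc//.
      by rewrite distrC (le_lt_trans zr).
    have st : `|c t - c s| < h + h by rewrite (lt_trans (sc sI))// ltrDl.
    split; first by apply: dOm; rewrite -ball_normE/=; exact: lt_le_trans zt hd.
    move=> v.
    have h1 : `|'d f z v - 'd f (c t) v| <= k / 2 * `|v|.
      by apply: edf; rewrite -ball_normE/=; exact: lt_le_trans zt he.
    have h2 : `|'d f (c s) v - 'd f (c t) v| <= k / 2 * `|v|.
      by apply: edf; rewrite -ball_normE/=; exact: lt_le_trans st he.
    rewrite -(subrKA ('d f (c t) v)) (le_trans (ler_normD _ _))//.
    have -> : k * `|v| = k / 2 * `|v| + k / 2 * `|v| by rewrite -mulrDl -splitr.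
    by apply: lerD; [exact: h1|rewrite distrC; exact: h2].
  near (0 : R)^'+ => r; exists r => //.
  by near: r; exact: near_Q.
exists r => // t tI; have {}Qr := Qr t tI tI.
split=> [v vr|v w vr wr].
  by have [] := Qr (c t + v); rewrite // addrC addKr.
pose seg (s : R) : V := c t + w + s *: (v - w).
have segr (s : R) : s \in `[0, 1] -> `|seg s - c t| <= r.
  rewrite in_itv/= => /andP[s0 s1].
  have -> : seg s - c t = (1 - s) *: w + s *: v.
    rewrite /seg scalerBr scalerBl scale1r addrAC [c t + w]addrC addrK.
    by rewrite addrA addrAC.
  rewrite (le_trans (ler_normD _ _))// !normrZ !ger0_norm// ?subr_ge0//.
  by nra.
pose g s := f (seg s) - s *: 'd f (c t) (v - w).
have dg (s : R) : s \in `[0, 1] ->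
    is_derive s 1 g ('d f (seg s) (v - w) - 'd f (c t) (v - w)).
  move=> sI; have [Os _] := Qr _ (segr _ sI).
  have h1 := is_derive_along (hf.1 _ Os).
  have h2 : is_derive s 1 (fun r : R => r *: 'd f (c t) (v - w)) ('d f (c t) (v - w)).
    apply/is_derive_mxP => i j.
    have := is_deriveZ ('d f (c t) (v - w) i j) (is_derive_id (s : R^o) 1).
    rewrite /GRing.scale/= mulr1.
    by congr is_derive; apply/funext => q; rewrite !mxE mulrC.
  exact: is_deriveB h1 h2.
have := mx_lipschitz ler01 dg (C := k * `|v - w|).
rewrite subr0 mulr1 /g scale1r scale0r subr0 /seg scale1r scale0r addr0.
have -> : c t + w + (v - w) = c t + v by rewrite -addrA [w + _]addrC subrK.
by rewrite [X in `|X| <= _]addrAC; apply => s sI; have [_] := Qr _ (segr _ sI); exact.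
Unshelve. all: by end_near. Qed.

End C1_on_compact.

(** * Steering the nonlinear system *)

Section steering.
Context {R : realType} {n p : nat}.
Variables (t0 t1 : R) (Phi Psi P : R -> 'M[R]_n) (W : R -> 'M[R]_(p, n)).
Hypothesis t01 : t0 < t1.
Hypotheses (cPhi : {within `[t0, t1], continuous Phi})
  (cPsi : {within `[t0, t1], continuous Psi})
  (cP : {within `[t0, t1], continuous P})
  (cW : {within `[t0, t1], continuous W}).
Local Notation V := ('cV[R]_n * 'cV[R]_p)%type.

(* For a source [q], the parameter [c] is chosen so that
   [y = a + P c + \int q] goes from [a] to [b]. *)
Definition steer_param (a b : 'cV[R]_n) (q : R -> 'cV[R]_n) : 'cV[R]_n :=
  invmx (P t1) *m (b - a - prim t0 q t1).

Definition steer_state a b q t : 'cV[R]_n :=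
  a + P t *m steer_param a b q + prim t0 q t.

Definition steer_pair a b q t : V :=
  (Phi t *m steer_state a b q t, W t *m steer_param a b q).

(** The pair is affine in [(a, b, q)], so differences reduce to the case [a = b = 0], and a bound on
    its size also serves as a Lipschitz estimate. *)
Lemma steer_pairB a b q q' t : continuous q -> continuous q' -> t0 <= t ->
  steer_pair a b q t - steer_pair a b q' t =
  steer_pair 0 0 (fun s => q s - q' s) t.
Proof.
move=> cq cq' tt0; have pB s := @primB R n 1 t0 q q' s cq cq'.
have pE : steer_param a b q - steer_param a b q' =
    steer_param 0 0 (fun s => q s - q' s).
  rewrite /steer_param -mulmxBr subr0 sub0r -pB ?ltW//; congr (_ *m _).
  by apply/matrixP => i j; rewrite !mxE; ring.
have sE : steer_state a b q t - steer_state a b q' t =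
    steer_state 0 0 (fun s => q s - q' s) t.
  rewrite /steer_state -pE -pB// mulmxBr add0r.
  by apply/matrixP => i j; rewrite !mxE; ring.
by congr pair; rewrite -mulmxBr ?sE ?pE.
Qed.

Lemma steer_le : exists2 C : R, 0 < C & forall a b q (M : R),
  continuous q -> (forall s, `|q s| <= M) ->
  `|steer_param a b q| <= C * (`|a| + `|b| + M) /\
  forall t, t \in `[t0, t1] -> `|steer_pair a b q t| <= C * (`|a| + `|b| + M).
Proof.
have t01W := ltW t01.
have [CF CF0 FC] := continuous_segment_bounded t01W cPhi.
have [CP CP0 PC] := continuous_segment_bounded t01W cP.
have [CW CW0 WC] := continuous_segment_bounded t01W cW.
(* [T] exceeds the length of the segment and is at least 1, so it also absorbs the coefficients of
   [|a|] and [|b|]. *)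
pose T := 1 + (t1 - t0).
have T1 : 1 <= T by rewrite lerDl subr_ge0.
have T0 : 0 <= T by rewrite (le_trans _ T1).
pose K := n%:R * `|invmx (P t1)| * T.
have K0 : 0 <= K by rewrite !mulr_ge0.
pose L := T + n%:R * CP * K.
have L0 : 0 <= L by rewrite addr_ge0// !mulr_ge0// ltW.
have prim_le (q : R -> 'cV[R]_n) (M : R) t : continuous q -> (forall s, `|q s| <= M) ->
    t \in `[t0, t1] -> `|prim t0 q t| <= T * M.
  move=> cq qM; rewrite in_itv/= => /andP[tt0 tt1].
  have M0 : 0 <= M := le_trans (normr_ge0 _) (qM t0).
  apply: le_trans (prim_norm_le cq tt0 (fun s _ => qM s)) _.
  rewrite mulrC ler_wpM2r//; rewrite /T; lra.
exists (1 + K + n%:R * CF * L + n%:R * CW * K).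
  by rewrite ltr_wpDr ?mulr_ge0// ?(ltW CW0)// ltr_wpDr ?mulr_ge0// ?(ltW CF0)// ltr_wpDr.
move=> a b q M cq qM.
have M0 : 0 <= M := le_trans (normr_ge0 _) (qM t0).
set s := `|a| + `|b| + M.
have s0 : 0 <= s by rewrite !addr_ge0.
have pT : `|a| + `|b| + T * M <= T * s.
  have := normr_ge0 a; have := normr_ge0 b; rewrite /s; nra.
have t1I : t1 \in `[t0, t1] by rewrite in_itv/= t01W lexx.
have c_le : `|steer_param a b q| <= K * s.
  apply: le_trans (mulmx_norm_le _ _) _.
  rewrite /K -[leRHS]mulrA ler_wpM2l ?mulr_ge0//; apply: le_trans pT.
  apply: le_trans (ler_normB _ _) _; rewrite lerD ?prim_le//.
  by rewrite (le_trans (ler_normB _ _))// addrC.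
have FL0 : 0 <= n%:R * CF * L by apply: mulr_ge0 => //; apply: mulr_ge0 => //; exact: ltW.
have WK0 : 0 <= n%:R * CW * K by apply: mulr_ge0 => //; apply: mulr_ge0 => //; exact: ltW.
split; first by apply: le_trans c_le _; rewrite ler_wpM2r//; lra.
move=> t tI.
have s_le : `|steer_state a b q t| <= L * s.
  have h1 : `|P t *m steer_param a b q| <= n%:R * CP * (K * s).
    apply: le_trans (mulmx_norm_le _ _) _.
    by rewrite ler_pM ?mulr_ge0// ler_wpM2l ?PC.
  have h2 := prim_le _ _ _ cq qM tI.
  rewrite /L mulrDl -[X in _ + X]mulrA; apply: le_trans (ler_normD _ _) _.
  apply: le_trans (lerD (ler_normD _ _) (lexx _)) _.
  have := normr_ge0 b; lra.
rewrite prod_normE/= ge_max; apply/andP; split.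
- apply: (@le_trans _ _ (n%:R * CF * L * s)); last by rewrite ler_wpM2r//; lra.
  apply: le_trans (mulmx_norm_le _ _) _; rewrite -[leRHS]mulrA.
  by rewrite ler_pM ?mulr_ge0// ler_wpM2l ?FC.
- apply: (@le_trans _ _ (n%:R * CW * K * s)); last by rewrite ler_wpM2r//; lra.
  apply: le_trans (mulmx_norm_le _ _) _; rewrite -[leRHS]mulrA.
  by rewrite ler_pM ?mulr_ge0// ler_wpM2l ?WC.
Qed.

Lemma continuous_steer_pair a b q : continuous q ->
  {within `[t0, t1], continuous (steer_pair a b q)}.
Proof.
move=> cq.
have cQ : {within `[t0, t1], continuous (prim t0 q)}.
  apply: derivable_within_continuous => s.
  by rewrite in_itv/= => /andP[st0 _]; have [] := is_derive_prim cq st0.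
have cPc : {within `[t0, t1], continuous (fun t => P t *m steer_param a b q)}.
  exact: within_continuous_mulmxr.
have h1 : {within `[t0, t1], continuous (fun t => Phi t *m steer_state a b q t)}.
  move=> t; apply: continuous_mulmx; first exact: cPhi.
  apply: cvgD; last exact: cQ.
  by apply: cvgD; [exact: cvg_cst|exact: cPc].
have h2 : {within `[t0, t1], continuous (fun t => W t *m steer_param a b q)}.
  exact: within_continuous_mulmxr.
move=> t; exact: (cvg_pair (h1 t) (h2 t)).
Qed.

(** The steering has a bounded gain and the remainder an arbitrarily small Lipschitz constant near
    0, so their composition is a contraction. Continuity of [rho] is asked along small curves only,
    because [f] is regular only on [Om]. *)
Lemma nonlinear_steering (rho : R -> V -> 'cV[R]_n) :
  (forall t, rho t 0 = 0) ->
  (forall e : R, 0 < e -> exists2 r : R, 0 < r &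
     forall t v w, t \in `[t0, t1] -> `|v| <= r -> `|w| <= r ->
       `|rho t v - rho t w| <= e * `|v - w|) ->
  (exists2 r : R, 0 < r & forall v : R -> V,
    {within `[t0, t1], continuous v} ->
    (forall t, t \in `[t0, t1] -> `|v t| <= r) ->
    {within `[t0, t1], continuous (fun t => rho t (v t))}) ->
  forall e : R, 0 < e -> exists2 d : R, 0 < d &
  forall a b : 'cV[R]_n, `|a| + `|b| <= d -> exists q : R -> 'cV[R]_n,
  [/\ continuous q,
      `|steer_param a b q| <= e,
      forall t, t \in `[t0, t1] -> `|steer_pair a b q t| <= e &
      forall t, t \in `[t0, t1] -> q t = Psi t *m rho t (steer_pair a b q t)].
Proof.
move=> rho0 rho_lip [r1 r10 rhoc] e e0.
have t01W := ltW t01.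
have [C C0 steerC] := steer_le.
have [Cs Cs0 PsiC] := continuous_segment_bounded t01W cPsi.
(* Gain of the loop: [n Cs] for the product by [Psi], [C] for the steering. A Lipschitz constant
   [1 / (2 G)] brings it down to at most 1/2; the [+ 1] keeps [G] positive. *)
pose G := n%:R * Cs * C + 1.
have nC0 : 0 <= n%:R * Cs * C by apply: mulr_ge0; [apply: mulr_ge0|] => //; exact: ltW.
have G0 : 0 < G by rewrite ltr_wpDl.
have [r2 r20 lip] := rho_lip (1 / 2 / G) (divr_gt0 (divr_gt0 ltr01 (ltr0Sn R 1)) G0).
pose r := Num.min (Num.min r1 r2) e.
have r0 : 0 < r by rewrite !lt_min r10 r20.
have rr1 : r <= r1 by rewrite !ge_min lexx.
have rr2 : r <= r2 by rewrite !ge_min lexx orbT.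
have re : r <= e by rewrite !ge_min lexx orbT.
(* The same [d] bounds the data [|a| + |b|] and the source [q], so that [C (d + d) = r]. *)
pose d := r / (2 * C).
have d0 : 0 < d by rewrite divr_gt0// mulr_gt0.
exists d => // a b abd.
have Cd (M : R) : M <= d -> C * (`|a| + `|b| + M) <= r.
  move=> Md; apply: (@le_trans _ _ (C * (2 * d))).
    by rewrite ler_wpM2l ?(ltW C0)//; lra.
  by rewrite mulrCA mulrA /d mulrC divfK// gt_eqF// mulr_gt0.
pose F0 q t := Psi t *m rho t (steer_pair a b q t).
pose F q := F0 q \o clamp t0 t1.
have small q t : continuous q -> (forall t, `|q t| <= d) -> t \in `[t0, t1] ->
    `|steer_pair a b q t| <= r.
  move=> cq qd tI; apply: le_trans (Cd d (lexx d)).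
  by have [_] := steerC a b q d cq qd; exact.
have F0_le t v w : t \in `[t0, t1] -> `|v| <= r -> `|w| <= r ->
    `|Psi t *m rho t v - Psi t *m rho t w| <= n%:R * Cs * (1 / 2 / G * `|v - w|).
  move=> tI vr wr; rewrite -mulmxBr (le_trans (mulmx_norm_le _ _))//.
  rewrite ler_pM ?mulr_ge0// ?ler_wpM2l ?PsiC//.
  by apply: lip => //; [exact: le_trans vr rr2|exact: le_trans wr rr2].
have half (x : R) : 0 <= x -> n%:R * Cs * (1 / 2 / G * (C * x)) <= 1 / 2 * x.
  move=> x0.
  have -> : n%:R * Cs * (1 / 2 / G * (C * x)) = (n%:R * Cs * C) / G * (1 / 2 * x).
    by ring.
  by rewrite ler_piMl ?mulr_ge0// ler_pdivrMr// mul1r lerDl.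
have [q [cq qd Fq]] : exists q, [/\ continuous q, (forall t, `|q t| <= d) & F q = q].
  apply: (@uniform_contraction_fixpoint _ _ _ _ F d (1 / 2)); first exact: ltW.
  - by apply/andP; split; lra.
  - move=> q cq qd; split.
      apply: continuous_clamp => // t; apply: continuous_mulmx; first exact: cPsi.
      apply: rhoc; first exact: continuous_steer_pair.
      by move=> s sI; apply: le_trans rr1; exact: small.
    move=> t; rewrite /F/= /F0.
    have := clamp_itv t t01W; move: (clamp t0 t1 t) => {}t tI.
    have z0 : `|0 : V| <= r by rewrite normr0 ltW.
    have := F0_le t _ _ tI (small q t cq qd tI) z0.
    rewrite rho0 mulmx0 !subr0 => h; apply: le_trans h _.
    (* Comparison with the value at 0: data and source contribute [d] each, and the factor 1/2
       brings [d + d] back to [d]. *)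
    apply: (@le_trans _ _ (n%:R * Cs * (1 / 2 / G * (C * (d + d))))).
      rewrite ler_wpM2l ?mulr_ge0 ?(ltW Cs0)// ler_wpM2l ?divr_ge0 ?(ltW G0)//.
      have [_ /(_ t tI) h] := steerC a b q d cq qd.
      by apply: le_trans h _; rewrite ler_wpM2l ?(ltW C0)// lerD2r.
    apply: le_trans (half _ _) _; first by rewrite addr_ge0 ?(ltW d0).
    by lra.
  - move=> q q' x cq cq' qd qd' qq' t; rewrite /F/= /F0.
    have := clamp_itv t t01W; move: (clamp t0 t1 t) => {}t tI.
    apply: le_trans (F0_le t _ _ tI (small q t cq qd tI) (small q' t cq' qd' tI)) _.
    have x0 : 0 <= x := le_trans (normr_ge0 _) (qq' t).
    apply: le_trans (half x x0).
    rewrite ler_wpM2l ?mulr_ge0 ?(ltW Cs0)// ler_wpM2l ?divr_ge0 ?(ltW G0)//.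
    have tt0 : t0 <= t by move: tI; rewrite in_itv/= => /andP[].
    rewrite steer_pairB//.
    have cqq : continuous (fun s => q s - q' s).
      by move=> s; apply: cvgB; [exact: cq|exact: cq'].
    have [_ /(_ t tI)] := steerC 0 0 _ x cqq qq'.
    by rewrite !normr0 !add0r.
exists q; split => //.
- apply: le_trans re; apply: le_trans (Cd d (lexx d)).
  by have [] := steerC a b q d cq qd.
- by move=> t tI; apply: le_trans re; exact: small.
- by move=> t tI; rewrite -[LHS](congr1 (fun g => g t) Fq)/= /F/= clamp_id.
Qed.

End steering.

(** * Functions of class C^1 on a segment *)

Section C1_in_lemmas.
Context {R : realType} {V : normedModType R}.
Variables (a b : R).
Hypothesis ab : a < b.

(** A convergent difference quotient is bounded near [t], here by [1 + |l|], so [|g t - g s|] is at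
    most a multiple of [|t - s|]. *)
Lemma C1_in_continuous (g : R -> V) :
  C1_in `[a, b] g -> {within `[a, b], continuous g}.
Proof.
move=> [dg _]; apply/subspace_continuousP => t tI.
have [l hl] := (cvg_ex _).1 (dg t tI).
apply/cvgrPdist_le => e e0; rewrite near_withinE.
have /cvgrPdist_le/(_ _ (ltr01 : (0 : R) < 1))[d /= d0 hd] := hl.
pose M := 1 + `|l|.
have M0 : 0 < M by rewrite ltr_wpDr.
exists (Num.min d (e / M)); first by rewrite /= lt_min d0 divr_gt0.
move=> s; rewrite /ball_/= lt_min => /andP[sd se] sI.
have [->|st] := eqVneq s t; first by rewrite subrr normr0 ltW.
have hs := hd s sd st sI.
have dM : `|diff_quot g t s| <= M.
  have -> : diff_quot g t s = l - (l - diff_quot g t s) by rewrite opprB addrC subrK.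
  by rewrite (le_trans (ler_normB _ _))// addrC lerD2r.
have -> : g t - g s = - ((s - t) *: diff_quot g t s).
  by rewrite /diff_quot scalerA divff ?subr_eq0// scale1r opprB.
rewrite normrN normrZ distrC.
apply: (@le_trans _ _ (e / M * M)); last by rewrite divfK// gt_eqF.
by rewrite ler_pM// ltW.
Qed.

Lemma derive_in_is_derive (h : R -> V) t dh : t \in `[a, b] ->
  is_derive t 1 h dh -> derive_in `[a, b] h t = dh.
Proof.
move=> tI hdh; have pf := within_dnbhs_proper ab tI.
exact: (cvg_lim (@norm_hausdorff _ V) (is_derive_diff_quot `[a, b] hdh)).
Qed.

(** The two summands are treated differently because the reference trajectory has derivatives
    relative to the segment only, the corrections two-sided ones. *)
Lemma C1_inD (g h dh : R -> V) : C1_in `[a, b] g ->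
  (forall t, t \in `[a, b] -> is_derive t 1 h (dh t)) ->
  {within `[a, b], continuous dh} ->
  C1_in `[a, b] (fun t => g t + h t) /\
  forall t, t \in `[a, b] ->
    derive_in `[a, b] (fun s => g s + h s) t = derive_in `[a, b] g t + dh t.
Proof.
move=> [dg cdg] hdh cdh.
have key t : t \in `[a, b] ->
    diff_quot (fun s => g s + h s) t s @[s --> within `[a, b] t^'] -->
    derive_in `[a, b] g t + dh t.
  move=> tI; have pf := within_dnbhs_proper ab tI.
  have -> : diff_quot (fun s => g s + h s) t = diff_quot g t \+ diff_quot h t.
    by apply/funext => s; rewrite /diff_quot /= opprD addrACA scalerDr.
  apply: cvgD; first exact: dg.
  exact: is_derive_diff_quot (hdh _ tI).
have keyE t : t \in `[a, b] ->
    derive_in `[a, b] (fun s => g s + h s) t = derive_in `[a, b] g t + dh t.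
  move=> tI; have pf := within_dnbhs_proper ab tI.
  exact: (cvg_lim (@norm_hausdorff _ V) (key t tI)).
split => //; split=> [t tI|].
  by apply/cvg_ex; exists (derive_in `[a, b] g t + dh t); exact: key.
apply: (@subspace_eq_continuous _ _ _ (fun t => derive_in `[a, b] g t + dh t)).
  by move=> t; rewrite inE => tI; exact/esym/keyE.
by move=> t; apply: cvgD; [exact: cdg|exact: cdh].
Qed.

Lemma C1_norm_le (h dh : R -> V) (e : R) :
  (forall t, t \in `[a, b] -> is_derive t 1 h (dh t)) ->
  (forall t, t \in `[a, b] -> `|h t| <= e / 2) ->
  (forall t, t \in `[a, b] -> `|dh t| <= e / 2) ->
  C1_norm `[a, b] h <= e.
Proof.
move=> hdh he dhe; rewrite /C1_norm [leRHS]splitr.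
have aI : `[a, b]%classic a by rewrite /= in_itv/= lexx ltW.
apply: lerD; apply: ge_sup.
- by exists `|h a|, a.
- by move=> _ [t tI <-]; exact: he.
- by exists `|derive_in `[a, b] h a|, a.
- by move=> _ [t tI <-]; rewrite (derive_in_is_derive tI (hdh _ tI)) dhe.
Qed.

End C1_in_lemmas.

(** Allows the Jacobians along the trajectory to be replaced by their continuous extensions. *)
Lemma linear_solution_eq {R : realType} {n p : nat} (A A' : R -> 'M[R]_n)
    (B B' : R -> 'M[R]_(n, p)) (t0 t1 : R) x u :
  (forall t, t \in `[t0, t1] -> A t = A' t) ->
  (forall t, t \in `[t0, t1] -> B t = B' t) ->
  linear_solution A B t0 t1 x u -> linear_solution A' B' t0 t1 x u.
Proof.
move=> AA' BB' [cx Fi xE].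
have FE t : t \in `[t0, t1] -> A t *m x t + B t *m u t = A' t *m x t + B' t *m u t.
  by move=> tI; rewrite AA'// BB'.
split => // [i|t tI i].
  by apply: eq_integrable (Fi i) => // s; rewrite inE => sI; rewrite FE.
rewrite (xE t tI i); congr (_ + _); apply: eq_Rintegral => s.
rewrite inE /= => sI; rewrite FE//.
by move: sI tI; rewrite !in_itv/= => /andP[-> st] /andP[_ tt1]; exact: le_trans tt1.
Qed.

Lemma ball_norm_lt {R : realType} m n (x y : 'M[R]_(m, n)) (d : R) :
  ball x d y -> `|y - x| < d.
Proof. by rewrite -ball_normE/= distrC. Qed.

Theorem theorem8p1 (R : realType) (n p : nat) (t0 t1 : R) (ht : t0 < t1)
  (Om : set ('cV[R]_n * 'cV[R]_p)) (hOm : open Om)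
  (f : 'cV[R]_n * 'cV[R]_p -> 'cV[R]_n) (hf : C1_open Om f)
  (xbar : R -> 'cV[R]_n) (ubar : R -> 'cV[R]_p)
  (htraj : C1_trajectory Om f t0 t1 xbar ubar)
  (hlin : linear_controllable (fun t => jac_x f (xbar t) (ubar t))
            (fun t => jac_u f (xbar t) (ubar t)) t0 t1) :
  locally_controllable Om f t0 t1 xbar ubar.
Proof.
have [xC1 uC1 inOm xode] := htraj.
have ht' : t0 <= t1 := ltW ht.
have t0I : t0 \in `[t0, t1] by rewrite in_itv/= lexx.
have t1I : t1 \in `[t0, t1] by rewrite in_itv/= ht' lexx.
pose c t := (xbar t, ubar t).
have cc : {within `[t0, t1], continuous c}.
  have xc := C1_in_continuous xC1; have uc := C1_in_continuous uC1.
  by move=> t; exact: (cvg_pair (xc t) (uc t)).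
have df t : t \in `[t0, t1] -> differentiable f (c t).
  by move=> tI; apply: hf.1; exact: inOm.
pose A0 t := jac_x f (xbar t) (ubar t).
pose B0 t := jac_u f (xbar t) (ubar t).
have diffE t z w : t \in `[t0, t1] -> 'd f (c t) (z, w) = A0 t *m z + B0 t *m w.
  by move=> tI; exact: diff_jacE (df t tI).
have dfc v : {within `[t0, t1], continuous (fun t => 'd f (c t) v)}.
  apply/subspace_continuousP => t tI.
  have /subspace_continuousP/(_ t tI) ct := cc.
  exact: cvg_diff_along hf _ _ _ _ _ _ ct (inOm _ tI).
have cA0 : {within `[t0, t1], continuous A0}.
  move=> t; apply/continuous_mxP => i j; move: t.
  apply: (@subspace_eq_continuous _ _ _
    (fun t => 'd f (c t) (delta_mx j ord0, 0) i ord0)) => [t|t].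
    by rewrite inE => tI; exact/esym/jac_xE/df.
  by have /continuous_mxP := dfc (delta_mx j ord0, 0) t; exact.
have cB0 : {within `[t0, t1], continuous B0}.
  move=> t; apply/continuous_mxP => i j; move: t.
  apply: (@subspace_eq_continuous _ _ _
    (fun t => 'd f (c t) (0, delta_mx j ord0) i ord0)) => [t|t].
    by rewrite inE => tI; exact/esym/jac_uE/df.
  by have /continuous_mxP := dfc (0, delta_mx j ord0) t; exact.
pose A := A0 \o clamp t0 t1; pose B := B0 \o clamp t0 t1.
have cA : continuous A by exact: continuous_clamp.
have cB : continuous B by exact: continuous_clamp.
have AE t : t \in `[t0, t1] -> A t = A0 t by move=> tI; rewrite /A/= clamp_id.
have BE t : t \in `[t0, t1] -> B t = B0 t by move=> tI; rewrite /B/= clamp_id.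
have {}hlin : linear_controllable A B t0 t1.
  move=> x0 x1; have [u [uL [x [xu h0 h1]]]] := hlin x0 x1.
  exists u; split; [exact: uL|exists x; split; [|exact: h0|exact: h1]].
  exact: linear_solution_eq (fun t tI => esym (AE t tI)) (fun t tI => esym (BE t tI)) xu.
have [Phi [Phi0 dPhi]] := linear_ode_fundamental ht' cA.
(* The transpose of a fundamental matrix of [Y' = - A^T Y] solves [Psi' = - Psi A]. *)
have cAT : continuous (fun t => - (A t)^T).
  by move=> t; apply: cvgN; apply: continuous_trmx; exact: cA.
have [Y [Y0 dY]] := linear_ode_fundamental ht' cAT.
pose Psi t := (Y t)^T.
have Psi0 : Psi t0 = 1%:M by rewrite /Psi Y0 trmx1.
have dPsi t : t \in `[t0, t1] -> is_derive t 1 Psi (- (Psi t *m A t)).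
  move=> tI; have := is_derive_trmx (dY t tI).
  by rewrite mulNmx linearN/= trmx_mul trmxK.
have [W [dW [P [cdW [W0 P0] dWE dPE Punit]]]] :=
  C1_control_family ht cA cB Phi0 Psi0 dPhi dPsi hlin.
have dWI t : t \in `[t0, t1] -> is_derive t 1 W (dW t).
  by rewrite in_itv/= => /andP[tt0 _]; exact: dWE.
have PhiPsi t : t \in `[t0, t1] -> Phi t *m Psi t = 1%:M.
  by move=> tI; apply: mulmx1C; exact: (PsiPhi Phi0 Psi0 dPhi dPsi).
have cPhi : {within `[t0, t1], continuous Phi}.
  by apply: derivable_within_continuous => t /dPhi[].
have cPsi : {within `[t0, t1], continuous Psi}.
  by apply: derivable_within_continuous => t /dPsi[].
have cP : {within `[t0, t1], continuous P}.
  by apply: derivable_within_continuous => t /dPE[].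
have cW : {within `[t0, t1], continuous W}.
  by apply: derivable_within_continuous => t /dWI[].
pose rho t v := f (c t + v) - f (c t) - 'd f (c t) v.
have rho0 t : rho t 0 = 0 by rewrite /rho addr0 linear0 subrr subr0.
have inOm' t : t \in `[t0, t1] -> Om (c t) by exact: inOm.
have rho_lip (e : R) : 0 < e -> exists2 r : R, 0 < r &
    forall t v w, t \in `[t0, t1] -> `|v| <= r -> `|w| <= r ->
    `|rho t v - rho t w| <= e * `|v - w|.
  move=> e0; have [r r0 hr] := C1_remainder_lipschitz hOm hf cc inOm' e0.
  exists r => // t v w tI vr wr; have [_ /(_ v w vr wr)] := hr t tI.
  rewrite linearB; congr (`|_| <= _); rewrite /rho.
  by apply/matrixP => i j; rewrite !mxE; ring.
(* Called for the radius [r1] within which [c t + v] stays in [Om]; the constant 1 is arbitrary. *)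
have [r1 r10 hr1] := C1_remainder_lipschitz hOm hf cc inOm' ltr01.
have fcv (v : R -> 'cV[R]_n * 'cV[R]_p) : {within `[t0, t1], continuous v} ->
    (forall t, t \in `[t0, t1] -> `|v t| <= r1) ->
    {within `[t0, t1], continuous (fun t => f (c t + v t))}.
  move=> cv vr1; apply/subspace_continuousP => t tI.
  have cvO : Om (c t + v t) by apply: (hr1 t tI).1; exact: vr1.
  have /subspace_continuousP/(_ t tI) h1 := cc.
  have /subspace_continuousP/(_ t tI) h2 := cv.
  apply: (cvg_comp _ _ (cvgD h1 h2)).
  exact: differentiable_continuous (hf.1 _ cvO).
have c0 : {within `[t0, t1], continuous (fun _ : R => 0 : 'cV[R]_n * 'cV[R]_p)}.
  by apply: continuous_subspaceT; exact: cst_continuous.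
have fcc : {within `[t0, t1], continuous (fun t => f (c t))}.
  apply: (subspace_eq_continuous _ (fcv _ c0 _)) => [t _|t _].
    by congr f; exact: addr0.
  by rewrite normr0 ltW.
have rhoc : exists2 r : R, 0 < r & forall v : R -> 'cV[R]_n * 'cV[R]_p,
    {within `[t0, t1], continuous v} ->
    (forall t, t \in `[t0, t1] -> `|v t| <= r) ->
    {within `[t0, t1], continuous (fun t => rho t (v t))}.
  exists r1 => // v cv vr1.
  have cv1 : {within `[t0, t1], continuous (fun t => (v t).1)}.
    by move=> t; apply: (cvg_comp _ _ (cv t)); exact: cvg_fst.
  have cv2 : {within `[t0, t1], continuous (fun t => (v t).2)}.
    by move=> t; apply: (cvg_comp _ _ (cv t)); exact: cvg_snd.
  have cAv := within_continuous_mulmx cA0 cv1.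
  have cBv := within_continuous_mulmx cB0 cv2.
  have cfv := fcv _ cv vr1.
  apply: (@subspace_eq_continuous _ _ _ (fun t => f (c t + v t) - f (c t) -
    (A0 t *m (v t).1 + B0 t *m (v t).2))) => [t|t].
    by rewrite inE => tI; rewrite -diffE// -surjective_pairing.
  apply: cvgB; first by apply: cvgB; [exact: cfv|exact: fcc].
  by apply: cvgD; [exact: cAv|exact: cBv].
have [CW CW0 WC] := continuous_segment_bounded ht' cW.
have [CD CD0 DC] := continuous_segment_bounded ht' (continuous_subspaceT cdW).
have [CP CP0 PC] := continuous_segment_bounded ht' cPsi.
move=> e e0.
(* [K] dominates [n CW] and [n CD], so a parameter of norm at most [e / (2 K)] leaves [e / 2] for
   the control correction and [e / 2] for its derivative. The minimum with [r1] keeps the trajectory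
   in [Om]. *)
pose K := n%:R * (CW + CD) + 1.
have nCW : 0 <= n%:R * CW by rewrite mulr_ge0// ltW.
have nCD : 0 <= n%:R * CD by rewrite mulr_ge0// ltW.
have K0 : 0 < K by rewrite /K mulrDr ltr_wpDl// addr_ge0.
pose eta := Num.min r1 (e / 2 / K).
have eta0 : 0 < eta by rewrite lt_min r10 !divr_gt0.
have etar1 : eta <= r1 by rewrite ge_min lexx.
have etaK : eta <= e / 2 / K by rewrite ge_min lexx orbT.
have [d d0 steer] := nonlinear_steering ht cPhi cPsi cP cW rho0 rho_lip rhoc eta0.
(* Shares [d] between the two ends: [|a|] is at most [d / L], and [|b|], which carries the factor
   [Psi t1], at most [n CP d / L]. *)
pose L := 1 + n%:R * CP.
have L0 : 0 < L by rewrite ltr_wpDr// mulr_ge0// ltW.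
exists (d / L); first by rewrite divr_gt0.
move=> x0 x1 /ball_norm_lt hx0 /ball_norm_lt hx1.
(* End values of [y] in [x - xbar = Phi y], where [Phi t0 = 1] and [Psi t1] is inverse to
   [Phi t1]. *)
pose a := x0 - xbar t0; pose b := Psi t1 *m (x1 - xbar t1).
have abd : `|a| + `|b| <= d.
  apply: (@le_trans _ _ (d / L + n%:R * CP * (d / L))).
    rewrite lerD ?(ltW hx0)// (le_trans (mulmx_norm_le _ _))//.
    by rewrite ler_pM ?mulr_ge0// ?(ltW hx1)// ler_wpM2l ?PC.
  rewrite -[X in X + _]mul1r -mulrDl -/L mulrC divfK// gt_eqF//.
have [q [cq ce ve qE]] := steer a b abd.
set k := steer_param t0 t1 P a b q in ce.
pose y t := steer_state t0 t1 P a b q t.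
pose v t := steer_pair t0 t1 Phi P W a b q t.
pose z t := Phi t *m y t.
pose w t := W t *m k.
have vE t : v t = (z t, w t) by [].
pose dz t := f (c t + v t) - f (c t).
have dy t : t \in `[t0, t1] -> is_derive t 1 y (Psi t *m B t *m W t *m k + q t).
  move=> tI; have tt0 : t0 <= t by move: tI; rewrite in_itv/= => /andP[].
  have h1 := is_derive_mulmxr k (dPE t tI).
  have := is_deriveD (is_deriveD (is_derive_cst a t 1) h1) (is_derive_prim cq tt0).
  by rewrite add0r.
have dzE t : t \in `[t0, t1] -> is_derive t 1 z (dz t).
  (* The product rule and [Phi Psi = 1] give [A z + B w + rho]; the linear part is exactly the
     differential that [rho] subtracts, which leaves [f (c + v) - f c]. *)
  move=> tI; apply: is_derive_eq (is_derive_mulmx (dPhi t tI) (dy t tI)) _.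
  rewrite qE// mulmxDr !mulmxA PhiPsi// !mul1mx.
  rewrite /rho -/(v t) vE (diffE t)// -vE AE// BE// /z /w -!mulmxA.
  by rewrite addrA addrC subrK /dz vE.
have cv : {within `[t0, t1], continuous v} by exact: continuous_steer_pair.
have vr1 t : t \in `[t0, t1] -> `|v t| <= r1.
  by move=> tI; apply: le_trans etar1; exact: ve.
have cdz : {within `[t0, t1], continuous dz}.
  have cfv := fcv _ cv vr1.
  by move=> t; apply: cvgB; [exact: cfv|exact: fcc].
have dw t : t \in `[t0, t1] -> is_derive t 1 w (dW t *m k).
  by move=> /dWI; exact: is_derive_mulmxr.
have cdw : {within `[t0, t1], continuous (fun t => dW t *m k)}.
  by apply: within_continuous_mulmxr; exact: continuous_subspaceT.
have [xC1' xD] := C1_inD ht xC1 dzE cdz.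
have [uC1' uD] := C1_inD ht uC1 dw cdw.
have ctv t : (xbar t + z t, ubar t + w t) = c t + v t by [].
exists (fun t => xbar t + z t), (fun t => ubar t + w t); split.
- split => // t tI; rewrite ctv; first by apply: (hr1 t tI).1; exact: vr1.
  by rewrite xD// xode// /dz addrC subrK.
- have -> : (fun t => ubar t + w t - ubar t) = w.
    by apply/funext => t; rewrite addrC addKr.
  have bnd (X : 'M[R]_(p, n)) (CX : R) : 0 <= CX -> n%:R * CX <= K ->
      `|X| <= CX -> `|X *m k| <= e / 2.
    move=> CX0 CXK XC; apply: (@le_trans _ _ (K * (e / 2 / K))); last first.
      by rewrite mulrC divfK// gt_eqF.
    apply: le_trans (mulmx_norm_le _ _) _.
    rewrite ler_pM ?mulr_ge0//; last exact: le_trans ce etaK.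
    by apply: le_trans CXK; rewrite ler_wpM2l.
  apply: (C1_norm_le ht dw) => t tI; apply: bnd.
  + exact: ltW CW0.
  + by rewrite /K mulrDr -addrA lerDl addr_ge0.
  + exact: WC.
  + exact: ltW CD0.
  + by rewrite /K mulrDr [_ + n%:R * CD]addrC -addrA lerDl addr_ge0.
  + exact: DC.
- rewrite /z /y /steer_state Phi0 P0 prim_base mul0mx !addr0 mul1mx.
  by rewrite /a addrC subrK.
- have -> : z t1 = x1 - xbar t1.
    (* Invertibility of [P t1] enters here: it cancels the inverse in [steer_param], so that
       [y t1 = b]. *)
    rewrite /z /y /steer_state /steer_param mulmxA mulmxV// mul1mx.
    move: (prim t0 q t1) => Q.
    have -> : a + (b - a - Q) + Q = b by rewrite -addrA subrK addrC subrK.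
    by rewrite /b mulmxA PhiPsi// mul1mx.
  by rewrite addrC subrK.
Qed.
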